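(* Let $f^\circ=\mathbb 1_{[0,1)}$, $R>0$, let $0<s_\star<s^\star$ and let $\mathcal A$ be a set of strictly positive, non-increasing sequences bounded by $1$ with $\{(\exp(-j^{s}))_{j\in\mathbb N}:s\in[s_\star,s^\star]\}\subseteq\mathcal A$. Assume $|\varphi_j|\sim j^{-p}$ for some $p>1/2$. Then for every $\alpha\in(0,1)$ there exist $n_\circ\in\mathbb N$ and $\underline A_\alpha\in(0,\infty)$ such that for all $n\ge n_\circ$ and $A\in[0,\underline A_\alpha]$, $$\inf_\Delta\sup_{a\in\mathcal A}\mathcal R\big(\Delta\mid\mathcal E_a^R,A\rho_a(\delta n)\big)\ge1-\alpha,\qquad\delta:=(\log\log\log n\vee1)^{-1/2},$$ the infimum being over all tests $\Delta$.
   Context: Identify the circle with $[0,1)$. $L^2:=L^2([0,1))$ is the space of square-integrable complex-valued functions on $[0,1)$ with $\langle h_1,h_2\rangle=\int_0^1h_1\overline{h_2}$ and norm $\|\cdot\|_{L^2}$. $e_j(x):=\exp(-\mathrm i2\pi jx)$, $h_j:=\langle h,e_j\rangle$ for $j\in\mathbb Z$. $\mathcal D$ is the set of real-valued probability densities on $[0,1)$ in $L^2$. Circular convolution $(f\circledast\varphi)(y)=\int_0^1f(y-s-\lfloor y-s\rfloor)\varphi(s)ds$. The error density $\varphi\in\mathcal D$ is fixed with $|\varphi_j|>0$ for all $j\in\mathbb Z$; $|\varphi_j|\sim j^{-p}$ means there are constants $0<c\le C$ with $cj^{-p}\le|\varphi_j|\le Cj^{-p}$ for all $j\in\mathbb N$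 (recall $|\varphi_{-j}|=|\varphi_j|$). For $f\in\mathcal D$, $Y_1,\dots,Y_n$ i.i.d. with density $f\circledast\varphi$, joint law $\mathbb P_f$; a test is a measurable $\{0,1\}$-valued function of $(Y_1,\dots,Y_n)$. $[k]:=\{1,\dots,k\}$, $\nu_k:=(\sum_{|j|\in[k]}|\varphi_j|^{-4})^{1/4}$. $\rho_a(x):=\big(\min_{k\in\mathbb N}(a_k^2\vee\nu_k^2/x)\big)^{1/2}$ for $x>0$. $\mathcal E_a^R:=\{h\in L^2:2\sum_{j\in\mathbb N}a_j^{-2}|h_j|^2\le R^2\}$. Risk: $\mathcal R(\Delta\mid\mathcal E,\rho):=\mathbb P_{f^\circ}(\Delta=1)+\sup\{\mathbb P_f(\Delta=0):f\in\mathcal D,f-f^\circ\in\mathcal E,\|f-f^\circ\|_{L^2}\ge\rho\}$. *)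

(* Defs.v *)
From HB Require Import structures.
From mathcomp Require Import all_boot all_order all_algebra.
From mathcomp Require Import all_classical all_reals all_analysis.
Set Implicit Arguments. Unset Strict Implicit. Unset Printing Implicit Defensive.
Import Order.TTheory GRing.Theory Num.Theory.
Import numFieldNormedType.Exports.
Local Open Scope classical_set_scope.
Local Open Scope ring_scope.

Section defs.
Variable R : realType.
Notation mu := (@lebesgue_measure R).

Definition I01 : set R := `[0, 1[%classic.

(* |h_j|^2 for a real-valued h, with h_j = int_0^1 h(x) exp(i 2 pi j x) dx :
   |h_j|^2 = (int h cos(2 pi j x))^2 + (int h sin(2 pi j x))^2 *)
Definition fcoef_sq (h : R -> R) (j : int) : R :=
  (Rintegral mu I01 (fun x => h x * cos (2 * pi * j%:~R * x))) ^+ 2 +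
  (Rintegral mu I01 (fun x => h x * sin (2 * pi * j%:~R * x))) ^+ 2.

Definition fcoef_abs (h : R -> R) (j : int) : R := Num.sqrt (fcoef_sq h j).

Definition inL2 (h : R -> R) : Prop :=
  measurable_fun I01 h /\ (\int[mu]_(x in I01) ((h x) ^+ 2)%:E < +oo)%E.

Definition L2norm (h : R -> R) : R :=
  Num.sqrt (Rintegral mu I01 (fun x => (h x) ^+ 2)).

Definition density (f : R -> R) : Prop :=
  inL2 f /\
  {ae mu, forall x, I01 x -> 0 <= f x} /\
  (\int[mu]_(x in I01) (f x)%:E = 1)%E.

Definition fcirc : R -> R := \1_I01.

Definition cconv (f phi : R -> R) (y : R) : R :=
  Rintegral mu I01 (fun s => f (y - s - (Num.floor (y - s))%:~R) * phi s).

Fixpoint joint_int (g : R -> R) (n : nat) : (n.-tuple R -> R) -> R :=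
  match n return (n.-tuple R -> R) -> R with
  | 0 => fun F => F [tuple]
  | m.+1 => fun F =>
      Rintegral mu I01 (fun y => g y * joint_int g (fun t : m.-tuple R => F [tuple of y :: t]))
  end.

(* P_f(Delta = 1) and P_f(Delta = 0), Y_1..Y_n iid with density f conv phi *)
Definition Prob1 (phi : R -> R) (n : nat) (f : R -> R) (Delta : n.-tuple R -> bool) : R :=
  joint_int (cconv f phi) (fun y => (Delta y)%:R).
Definition Prob0 (phi : R -> R) (n : nat) (f : R -> R) (Delta : n.-tuple R -> bool) : R :=
  joint_int (cconv f phi) (fun y => (~~ Delta y)%:R).

Definition nu (phi : R -> R) (k : nat) : R :=
  (\sum_(i < k) ((fcoef_abs phi (Posz i.+1)) ^- 4 + (fcoef_abs phi (- Posz i.+1)) ^- 4)) `^ (4^-1).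

Definition rho (phi : R -> R) (a : nat -> R) (x : R) : R :=
  Num.sqrt (inf [set Num.max (a k ^+ 2) ((nu phi k) ^+ 2 / x) | k in [set k : nat | (0 < k)%N]]).

Definition ellipsoid (a : nat -> R) (Rad : R) (h : R -> R) : Prop :=
  inL2 h /\
  (2%:E * \sum_(1 <= j <oo) (((a j) ^- 2 * fcoef_sq h (Posz j))%:E) <= (Rad ^+ 2)%:E)%E.

Definition risk (phi : R -> R) (n : nat) (Delta : n.-tuple R -> bool)
    (E : (R -> R) -> Prop) (r : R) : R :=
  Prob1 phi fcirc Delta +
  sup [set Prob0 phi f Delta | f in
         [set f | density f /\ E (f \- fcirc) /\ r <= L2norm (f \- fcirc)]].

Definition delta (n : nat) : R :=
  (Num.max (ln (ln (ln n%:R))) 1) `^ (- 2^-1).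

Definition decay_like (phi : R -> R) (p : R) : Prop :=
  exists c C : R, 0 < c /\ c <= C /\
    forall j : nat, (0 < j)%N ->
      c * (j%:R `^ (- p)) <= fcoef_abs phi (Posz j) <= C * (j%:R `^ (- p)).

End defs.

(* Main.v *)
Require Import Defs.
From HB Require Import structures.
From mathcomp Require Import all_boot all_order all_algebra.
From mathcomp Require Import all_classical all_reals all_analysis.
From mathcomp Require Import measurable_realfun ring lra zify.
Import Order.TTheory GRing.Theory Num.Theory.
Import numFieldNormedType.Exports.
Local Open Scope classical_set_scope.
Local Open Scope ring_scope.

(* The alternatives live on disjoint dyadic frequency blocks (k/2, k], k = 2^(m+i):
   f = 1 + sum_j u_j cos(2 pi j x) with u_j = +-tau on block i, where tau is chosen so that
   ||f - 1||_{L^2}^2 = Abar^2 nu_k^2 / x, with x = delta n. For each of these k there is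
   s in [s_lo, s_hi] with exp(-2 k^s) = nu_k^2 / x, so that f lies in the ellipsoid of
   a_j = exp(-j^s) and is separated by at least Abar rho_a(x). Mixing uniformly over the
   signs and over N blocks, the cross terms of the chi-square divergence between different
   blocks vanish by orthogonality, and each diagonal term is at most exp(L/2) where
   L = logloglog n = delta^(-2). Since k may range over powers of log n, one can take
   N of order loglog n = exp(L), so the divergence exp(L/2)/N tends to 0. *)

(** * Bounded measurable functions and iterated integrals *)

(** Blocks replace the full ranges [1, k] so that different scales are orthogonal. A flat amplitude
    on the upper half of [1, k] loses only a constant: under polynomial decay nu_k^4 is at most of
    order k^(1+4p), while |phi_j| is at most of order k^(-p) throughout the block. The number of
    scales is governed by the exponents s. With l = log n and y = log l, the equation exp(-2 k^s) =
    nu_k^2 / x makes k^s comparable to l, so s = (y + O(1)) / ln k, and s in [s_lo, s_hi] amounts to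
    ln k in an interval of length of order y, which contains order y dyadic scales. Such k are
    bounded by powers of l, so nu_k^2 k stays below x and the perturbed densities are nonnegative.
    Two formal obstacles remain. The law of the sample is an iterated real-valued integral, so
    linearity needs integrability at every level; bounded measurable functions form a stable class
    for this. And [sup] is meaningful only for bounded sets, so error probabilities must be bounded
    for all square-integrable densities, which goes through an L^1 bound on convolutions. *)

Definition bmeas d (T : measurableType d) (R : realType) (f : T -> R) : Prop :=
  measurable_fun setT f /\ exists M : R, forall x, `|f x| <= M.
Arguments bmeas {d T R} f.

Section BMeas.
Context d (T : measurableType d) (R : realType).
Implicit Types f g : T -> R.

Lemma bmeas_cst (c : R) : bmeas (fun _ : T => c).
Proof. by split; [exact: measurable_cst|exists `|c|]. Qed.

Lemma bmeasD f g : bmeas f -> bmeas g -> bmeas (fun x => f x + g x).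
Proof.
move=> [mf [M fM]] [mg [N gN]]; split; first exact: measurable_funD.
by exists (M + N) => x; rewrite (le_trans (ler_normD _ _))// lerD.
Qed.

Lemma bmeasM f g : bmeas f -> bmeas g -> bmeas (fun x => f x * g x).
Proof.
move=> [mf [M fM]] [mg [N gN]]; split; first exact: measurable_funM.
by exists (M * N) => x; rewrite normrM ler_pM.
Qed.

Lemma bmeasZ (c : R) f : bmeas f -> bmeas (fun x => c * f x).
Proof. by move=> bf; apply: bmeasM => //; exact: bmeas_cst. Qed.

Lemma bmeas_sum (I : Type) (s : seq I) (P : pred I) (F : I -> T -> R) :
  (forall i, P i -> bmeas (F i)) -> bmeas (fun x => \sum_(i <- s | P i) F i x).
Proof.
move=> bF; elim: s => [|i s IH].
  rewrite [X in bmeas X](_ : _ = fun=> 0); first exact: bmeas_cst.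
  by apply/funext => x; rewrite big_nil.
rewrite [X in bmeas X](_ : _ = if P i
    then fun x => F i x + \sum_(j <- s | P j) F j x
    else fun x => \sum_(j <- s | P j) F j x); last first.
  by apply/funext => x; rewrite big_cons; case: ifP.
by case: ifPn => // Pi; apply: bmeasD => //; exact: bF.
Qed.

Lemma bmeas_prod (I : Type) (s : seq I) (P : pred I) (F : I -> T -> R) :
  (forall i, P i -> bmeas (F i)) -> bmeas (fun x => \prod_(i <- s | P i) F i x).
Proof.
move=> bF; elim: s => [|i s IH].
  rewrite [X in bmeas X](_ : _ = fun=> 1); first exact: bmeas_cst.
  by apply/funext => x; rewrite big_nil.
rewrite [X in bmeas X](_ : _ = if P i
    then fun x => F i x * \prod_(j <- s | P j) F j x
    else fun x => \prod_(j <- s | P j) F j x); last first.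
  by apply/funext => x; rewrite big_cons; case: ifP.
by case: ifPn => // Pi; apply: bmeasM => //; exact: bF.
Qed.

Lemma bmeas_comp d' (T' : measurableType d') (h : T' -> T) f :
  measurable_fun setT h -> bmeas f -> bmeas (f \o h).
Proof.
move=> mh [mf [M fM]]; split; first exact: measurableT_comp.
by exists M => x; exact: fM.
Qed.

End BMeas.

(** * Integration of bounded functions over the unit interval *)

Section IntI01.
Variable R : realType.
Notation mu := (@lebesgue_measure R).
Notation I01 := (@I01 R).
Notation "''I' h" := (Rintegral mu I01 h) (at level 8).
Implicit Types f g h : R -> R.

Lemma measurable_I01 : measurable (I01 : set (measurableTypeR R)).
Proof. exact: measurable_itv. Qed.

Lemma mu_I01 : mu I01 = 1%E.
Proof. by rewrite /I01 lebesgue_measure_itv/= lte01 oppr0 adde0. Qed.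

Lemma bmeas_integrable h : bmeas h -> mu.-integrable I01 (EFin \o h).
Proof.
move=> [mh [M hM]]; apply: measurable_bounded_integrable.
- exact: measurable_I01.
- by rewrite [X in (X < _)%E](mu_I01) ltry.
- exact: measurable_funTS.
- exists M; split; first exact: num_real.
  by move=> N MN x _ /=; rewrite (le_trans (hM x))// ltW.
Qed.

Lemma int01_cst (c : R) : 'I (fun=> c) = c.
Proof.
rewrite Rintegral_cst; last exact: measurable_I01.
by rewrite [X in fine X](mu_I01) mulr1.
Qed.

Lemma int01D f g : bmeas f -> bmeas g ->
  'I (fun x => f x + g x) = 'I f + 'I g.
Proof.
by move=> bf bg; rewrite RintegralD//;
  [exact: measurable_I01|exact: bmeas_integrable|exact: bmeas_integrable].
Qed.

Lemma int01Z c f : bmeas f -> 'I (fun x => c * f x) = c * 'I f.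
Proof.
by move=> bf; rewrite RintegralZl//; [exact: measurable_I01|exact: bmeas_integrable].
Qed.

Lemma int01_sum (I : Type) (s : seq I) (F : I -> R -> R) :
  (forall i, bmeas (F i)) ->
  'I (fun x => \sum_(i <- s) F i x) = \sum_(i <- s) 'I (F i).
Proof.
move=> bF; elim: s => [|i s IH].
  by rewrite big_nil; under eq_Rintegral do rewrite big_nil; rewrite int01_cst.
rewrite big_cons; under eq_Rintegral do rewrite big_cons.
by rewrite int01D// ?IH//; exact: bmeas_sum.
Qed.

Lemma le_int01 f g : bmeas f -> bmeas g -> (forall x, f x <= g x) ->
  'I f <= 'I g.
Proof.
by move=> bf bg fg; apply: le_Rintegral => //;
  [exact: measurable_I01|exact: bmeas_integrable|exact: bmeas_integrable].
Qed.

Lemma int01_bound f (M : R) : bmeas f -> (forall x, `|f x| <= M) -> `|'I f| <= M.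
Proof.
move=> bf fM; rewrite ler_norml; apply/andP; split.
  rewrite -(int01_cst (- M)); apply: le_int01 => //; first exact: bmeas_cst.
  by move=> x; move: (fM x); rewrite ler_norml => /andP[].
rewrite -[leRHS](int01_cst M); apply: le_int01 => //; first exact: bmeas_cst.
by move=> x; move: (fM x); rewrite ler_norml => /andP[].
Qed.

(** Closure under integrating out a variable is what makes [bmeas] suitable for iterated integrals.
    Adding the bound M makes the integrand nonnegative, so that measurability follows from Tonelli;
    M is subtracted again since I01 has mass 1. *)
Lemma bmeas_int01_param d (T : measurableType d) (G : T * R -> R) :
  bmeas G -> bmeas (fun x => 'I (fun y => G (x, y))).
Proof.
move=> bG; have [mG [M GM]] := bG.
have M0 x : 0 <= G x + M by move: (GM x); rewrite ler_norml; lra.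
have bGx x : bmeas (fun y => G (x, y)).
  by apply: (@bmeas_comp _ _ _ _ _ (fun y => (x, y)) G) => //; exact: measurable_pair1.
split; last first.
  by exists M => x; apply: int01_bound => // y; exact: GM.
have -> : (fun x => 'I (fun y => G (x, y))) =
          fun x => fine (\int[mu]_y ((G (x, y) + M) * \1_I01 y)%:E) - M.
  apply/funext => x; rewrite [in RHS](_ : (fun y => _) =
      (fun y => (((fun y => G (x, y) + M) \_ I01) y)%:E)); last first.
    apply/funext => y; rewrite indicE patchE; case: ifPn => _; by rewrite (mulr1, mulr0).
  rewrite -[X in X - _]/(Rintegral mu setT _) -Rintegral_mkcond int01D//; last exact: bmeas_cst.
  by rewrite int01_cst addrK.
apply: measurable_funB; last exact: measurable_cst.
apply: measurableT_comp; first exact: fine_measurable.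
apply: (@measurable_fun_fubini_tonelli_F _ _ _ _ R mu
  (fun z : T * R => ((G z + M) * \1_I01 z.2)%:E)) => //.
- apply/measurable_EFinP; apply: measurable_funM.
    by apply: measurable_funD=> //; exact: measurable_cst.
  apply: measurableT_comp => //; apply: measurable_indic; exact: measurable_I01.
- by move=> x; rewrite lee_fin mulr_ge0// indicE.
Qed.

Lemma measurable_tcons n :
  measurable_fun setT (fun z : R * n.-tuple R => [tuple of z.1 :: z.2]).
Proof.
apply: (@measurable_cons _ _ _ _ (fun z : R * n.-tuple R => z.1) n (fun z => z.2));
  [exact: measurable_fst|exact: measurable_snd].
Qed.

(** * Iterated integrals against a product density *)

Section Joint.
Variable g : R -> R.
Hypothesis bg : bmeas g.

Lemma bmeas_tcons n (F : n.+1.-tuple R -> R) y : bmeas F ->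
  bmeas (fun t : n.-tuple R => F [tuple of y :: t]).
Proof.
move=> bF; apply: (@bmeas_comp _ _ _ _ _ (fun t : n.-tuple R => [tuple of y :: t]) F) => //.
apply: (@measurableT_comp _ _ _ _ _ _ (fun z : R * n.-tuple R => [tuple of z.1 :: z.2]) _
  (fun t => (y, t))); [exact: measurable_tcons|exact: measurable_pair1].
Qed.

(** The parameter space T is arbitrary because the induction moves the first coordinate of the
    sample from the tuple into the parameter. *)
Lemma bmeas_joint n d (T : measurableType d) (G : T * n.-tuple R -> R) :
  bmeas G -> bmeas (fun x => joint_int g (fun t => G (x, t))).
Proof.
elim: n d T G => [|n IH] d T G bG /=.
  apply: (@bmeas_comp _ _ _ _ _ (fun x : T => (x, [tuple])) G) => //.
apply: (@bmeas_int01_param _ _ (fun z : T * R =>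
   g z.2 * joint_int g (fun t : n.-tuple R => G (z.1, [tuple of z.2 :: t])))).
apply: bmeasM.
  by apply: (@bmeas_comp _ _ _ _ _ snd g).
apply: (IH _ _ (fun w : (T * R) * n.-tuple R => G (w.1.1, [tuple of w.1.2 :: w.2]))).
apply: (@bmeas_comp _ _ _ _ _ (fun w : (T * R) * n.-tuple R =>
  (w.1.1, [tuple of w.1.2 :: w.2])) G) => //.
apply/measurable_fun_pairP; split => /=.
  exact: (@measurableT_comp _ _ _ _ _ _ fst _ fst).
apply: (@measurable_cons _ _ _ _ (fun w : (T * R) * n.-tuple R => w.1.2) n (fun z => z.2)).
  exact: (@measurableT_comp _ _ _ _ _ _ snd _ fst).
exact: measurable_snd.
Qed.

Lemma bmeas_joint_step n (F : n.+1.-tuple R -> R) : bmeas F ->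
  bmeas (fun y => joint_int g (fun t : n.-tuple R => F [tuple of y :: t])).
Proof.
move=> bF.
apply: (@bmeas_joint n _ _ (fun z : R * n.-tuple R => F [tuple of z.1 :: z.2])).
apply: (@bmeas_comp _ _ _ _ _ (fun z : R * n.-tuple R => [tuple of z.1 :: z.2]) F) => //.
exact: measurable_tcons.
Qed.

Lemma jointD n (F G : n.-tuple R -> R) : bmeas F -> bmeas G ->
  joint_int g (fun t => F t + G t) = joint_int g F + joint_int g G.
Proof.
elim: n F G => [//|n IH] F G bF bG /=.
rewrite -int01D; [|by apply: bmeasM => //; exact: bmeas_joint_step..].
apply: eq_Rintegral => y _; rewrite -mulrDr IH//; exact: bmeas_tcons.
Qed.

Lemma jointZ n c (F : n.-tuple R -> R) : bmeas F ->
  joint_int g (fun t => c * F t) = c * joint_int g F.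
Proof.
elim: n F => [//|n IH] F bF /=.
rewrite -int01Z; last by apply: bmeasM => //; exact: bmeas_joint_step.
apply: eq_Rintegral => y _; rewrite mulrCA IH//; exact: bmeas_tcons.
Qed.

Lemma joint_sum n (I : Type) (s : seq I) (F : I -> n.-tuple R -> R) :
  (forall i, bmeas (F i)) ->
  joint_int g (fun t => \sum_(i <- s) F i t) = \sum_(i <- s) joint_int g (F i).
Proof.
move=> bF; elim: s => [|i s IH].
  rewrite big_nil (_ : (fun _ => _) = fun t : n.-tuple R => 0 * 0).
    by rewrite jointZ ?mul0r//; exact: bmeas_cst.
  by apply/funext => t; rewrite big_nil mul0r.
rewrite big_cons -IH -jointD//; last exact: bmeas_sum.
by congr joint_int; apply/funext => t; rewrite big_cons.
Qed.

Lemma le_joint n (F G : n.-tuple R -> R) : (forall x, 0 <= g x) ->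
  bmeas F -> bmeas G -> (forall t, F t <= G t) ->
  joint_int g F <= joint_int g G.
Proof.
move=> g0; elim: n F G => [|n IH] F G bF bG FG /=; first exact: FG.
apply: le_int01; [by apply: bmeasM => //; exact: bmeas_joint_step..|].
by move=> y; rewrite ler_wpM2l// IH//; exact: bmeas_tcons.
Qed.

Lemma joint_prod n (h : R -> R) : bmeas h ->
  joint_int g (fun t : n.-tuple R => \prod_(i < n) h (tnth t i)) =
  'I (fun y => g y * h y) ^+ n.
Proof.
move=> bh; elim: n => [|n IH] /=; first by rewrite big_ord0 expr0.
have bP m : bmeas (fun t : m.-tuple R => \prod_(i < m) h (tnth t i)).
  apply: bmeas_prod => i _.
  by apply: (@bmeas_comp _ _ _ _ _ (fun t : m.-tuple R => tnth t i) h) => //;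
    exact: measurable_tnth.
rewrite exprSr -IH -int01Z; last exact: bmeasM.
apply: eq_Rintegral => y _.
rewrite (_ : (fun t => _) =
    fun t : n.-tuple R => h y * \prod_(i < n) h (tnth t i)); last first.
  apply/funext => t; rewrite big_ord_recl tnth0; congr (_ * _).
  by apply: eq_bigr => i _; rewrite tnthS.
by rewrite jointZ//; ring.
Qed.

(** Change of measure: the laws of all alternatives become integrals against the single null law,
    weighted by likelihood products, and can then be averaged. *)
Lemma joint_tilt n (F : n.-tuple R -> R) (h : R -> R) : bmeas h -> bmeas F ->
  joint_int (fun y => g y * h y) F =
  joint_int g (fun t => (\prod_(i < n) h (tnth t i)) * F t).
Proof.
move=> bh; elim: n F => [|n IH] F bF /=; first by rewrite big_ord0 mul1r.
have bP m : bmeas (fun t : m.-tuple R => \prod_(i < m) h (tnth t i)).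
  apply: bmeas_prod => i _.
  by apply: (@bmeas_comp _ _ _ _ _ (fun t : m.-tuple R => tnth t i) h) => //;
    exact: measurable_tnth.
apply: eq_Rintegral => y _; rewrite IH; last exact: bmeas_tcons.
rewrite -mulrA -jointZ; last by apply: bmeasM => //; exact: bmeas_tcons.
congr (_ * joint_int _ _); apply/funext => t.
rewrite big_ord_recl tnth0 mulrA; congr (_ * _ * _).
by apply: eq_bigr => i _; rewrite tnthS.
Qed.

End Joint.
End IntI01.

(** * Chi-square bound for testing against a mixture *)

Section Mixture.
Variable R : realType.
Notation mu := (@lebesgue_measure R).
Notation I01 := (@I01 R).
Notation "''I' h" := (Rintegral mu I01 h) (at level 8).

Lemma bmeas_test n (Delta : n.-tuple R -> bool) :
  measurable (Delta @^-1` [set true]) -> bmeas (fun t => (Delta t)%:R : R).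
Proof.
move=> mD; split; last by exists 1 => t; case: (Delta t); rewrite ?normr0 ?normr1.
rewrite [X in measurable_fun _ X](_ : _ = \1_(Delta @^-1` [set true])).
  exact: measurable_indic.
apply/funext => t; rewrite indicE; congr (nat_of_bool _)%:R.
apply/idP/idP => [Dt|]; first by rewrite inE.
by rewrite inE.
Qed.

Lemma bmeas_ntest n (Delta : n.-tuple R -> bool) :
  measurable (Delta @^-1` [set true]) -> bmeas (fun t => (~~ Delta t)%:R : R).
Proof.
move=> mD; rewrite [X in bmeas X](_ : _ = fun t => 1 + -1 * (Delta t)%:R).
  by apply: bmeasD; [exact: bmeas_cst|apply: bmeasZ; exact: bmeas_test].
by apply/funext => t; case: (Delta t); rewrite ?mulr1 ?mulr0 ?subrr ?addr0.
Qed.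

Lemma bmeas_lik n (h : R -> R) : bmeas h ->
  bmeas (fun t : n.-tuple R => \prod_(i < n) h (tnth t i)).
Proof.
move=> bh; apply: bmeas_prod => i _.
by apply: (@bmeas_comp _ _ _ _ _ (fun t : n.-tuple R => tnth t i) h) => //;
  exact: measurable_tnth.
Qed.

(* With p the likelihood ratio of the mixture, 1 - p <= alpha/2 + (p-1)^2/(2 alpha):
   a chi-square bound on the mixture bounds the sum of the error probabilities. *)
Lemma mixture_error_ge (W : finType) (h : W -> R -> R) n
    (Delta : n.-tuple R -> bool) (alpha : R) :
  measurable (Delta @^-1` [set true]) -> 0 < alpha -> (0 < #|W|)%N ->
  (forall w, bmeas (h w)) -> (forall w, 'I (h w) = 1) ->
  \sum_w \sum_w' ('I (fun y => h w y * h w' y)) ^+ n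
    <= (1 + alpha ^+ 2) * #|W|%:R ^+ 2 ->
  1 - alpha <= joint_int (fun=> 1) (fun t => (Delta t)%:R) +
     #|W|%:R^-1 * \sum_w joint_int (h w) (fun t => (~~ Delta t)%:R).
Proof.
move=> mD a0 W0 bh h1 chi.
have b1 : bmeas (fun _ : R => 1 : R) by exact: bmeas_cst.
pose J := @joint_int R (fun=> 1) n.
pose L w (t : n.-tuple R) := \prod_(i < n) h w (tnth t i).
have bL w : bmeas (L w) by exact: bmeas_lik.
pose c : R := #|W|%:R^-1.
have c0 : 0 < c by rewrite invr_gt0 ltr0n.
pose p t := c * \sum_w L w t.
have bp : bmeas p by apply: bmeasZ; exact: bmeas_sum.
have JL w (F : n.-tuple R -> R) : bmeas F -> joint_int (h w) F = J (fun t => L w t * F t).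
  move=> bF; rewrite /J -joint_tilt// (_ : (fun y => 1 * h w y) = h w)//.
  by apply/funext => y; rewrite mul1r.
have JLL w w' : J (fun t => L w t * L w' t) = ('I (fun y => h w y * h w' y)) ^+ n.
  have := joint_prod _ _ b1 n _ (bmeasM _ _ _ _ _ (bh w) (bh w')).
  rewrite (_ : (fun y => 1 * _) = (fun y => h w y * h w' y)) => [<-|].
    by apply: (congr1 (@joint_int R (fun=> 1) n)); apply/funext => t; rewrite /L big_split.
  by apply/funext => y; rewrite mul1r.
have J1 : J (fun=> 1) = 1.
  have := joint_prod _ _ b1 n _ b1; rewrite int01_cst mulr1 expr1n => E; rewrite -[RHS]E.
  by apply: (congr1 (@joint_int R (fun=> 1) n)); apply/funext => t; rewrite big1.
have JL1 w : J (L w) = 1.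
  rewrite /J joint_prod// (_ : 'I _ = 1) ?expr1n// -[RHS](h1 w).
  by apply: eq_Rintegral => y _; rewrite mul1r.
have Jp : J p = 1.
  rewrite /J jointZ ?joint_sum//; last exact: bmeas_sum.
  rewrite (eq_bigr (fun=> 1)); last by move=> w _; exact: JL1.
  by rewrite sumr_const mulVf// pnatr_eq0 -lt0n.
have Jpp : J (fun t => p t * p t) <= 1 + alpha ^+ 2.
  have -> : (fun t => p t * p t) =
     fun t => c ^+ 2 * \sum_w \sum_w' (L w t * L w' t).
    apply/funext => t; rewrite /p mulrACA -expr2; congr (_ * _).
    by rewrite mulr_suml; apply: eq_bigr => w _; rewrite mulr_sumr.
  have bLL w w' : bmeas (fun t => L w t * L w' t) by exact: bmeasM.
  rewrite /J jointZ//; last by apply: bmeas_sum => w _; exact: bmeas_sum.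
  rewrite joint_sum//; last by move=> w; exact: bmeas_sum.
  rewrite (eq_bigr (fun w => \sum_w' ('I (fun y => h w y * h w' y)) ^+ n)); last first.
    move=> w _; rewrite joint_sum//; apply: eq_bigr => w' _; exact: JLL.
  rewrite exprVn ler_pdivrMl ?exprn_gt0 ?ltr0n// mulrC//.
have bD := bmeas_test _ _ mD; have bnD := bmeas_ntest _ _ mD.
have -> : c * \sum_w joint_int (h w) (fun t => (~~ Delta t)%:R) =
    J (fun t => (~~ Delta t)%:R * p t).
  have -> : (fun t => (~~ Delta t)%:R * p t) =
            fun t => c * \sum_w (L w t * (~~ Delta t)%:R).
    by apply/funext => t; rewrite mulrC -mulrA mulr_suml.
  rewrite /J jointZ ?joint_sum//; last by apply: bmeas_sum => w _; exact: bmeasM.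
    by congr (_ * _); apply: eq_bigr => w _; exact: JL.
  by move=> w; exact: bmeasM.
have ai0 : 0 < alpha^-1 by rewrite invr_gt0.
have aK : alpha * alpha^-1 = 1 by rewrite mulfV ?gt_eqF.
(* Constant term of the pointwise inequality after expanding (p - 1)^2 / (2 alpha), so that only the
   integrals of 1, p and p^2 remain. *)
pose k := 1 - (2^-1 * alpha^-1 + 2^-1 * alpha).
have : J (fun=> k * 1) <= J (fun t => (Delta t)%:R + ((~~ Delta t)%:R * p t +
    (2^-1 * alpha^-1 * (p t * p t) + (- alpha^-1) * p t))).
  apply: le_joint => //.
  - exact: bmeas_cst.
  - apply: bmeasD => //; apply: bmeasD; first exact: bmeasM.
    by apply: bmeasD; apply: bmeasZ => //; exact: bmeasM.
  move=> t; move: (p t) => q.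
  (* If the test rejects, the square of q - 1 suffices; otherwise the inequality is the
     nonnegativity of (q - 1 + alpha)^2 divided by 2 alpha. *)
  case: (Delta t); rewrite /= ?mulr0n ?mulr1n ?mul0r ?mul1r ?add0r /k mulr1.
    have : 0 <= alpha^-1 * ((q - 1) ^+ 2) by rewrite mulr_ge0 ?sqr_ge0// ltW.
    rewrite expr2; nra.
  have : 0 <= alpha^-1 * ((q - 1 + alpha) ^+ 2) by rewrite mulr_ge0 ?sqr_ge0// ltW.
  have -> : alpha^-1 * (q - 1 + alpha) ^+ 2 =
     alpha^-1 * q ^+ 2 - 2 * alpha^-1 * q + alpha^-1
     + 2 * (alpha * alpha^-1) * (q - 1) + (alpha * alpha^-1) * alpha by ring.
  rewrite aK; nra.
have bpp : bmeas (fun t => p t * p t) by exact: bmeasM.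
have b1' : bmeas (fun t => 2^-1 * alpha^-1 * (p t * p t)) by exact: bmeasZ.
have b2' : bmeas (fun t => - alpha^-1 * p t) by exact: bmeasZ.
have b3' : bmeas (fun t => (~~ Delta t)%:R * p t) by exact: bmeasM.
have b4' : bmeas (fun t => 2^-1 * alpha^-1 * (p t * p t) + - alpha^-1 * p t).
  exact: bmeasD.
have b5' : bmeas (fun t => (~~ Delta t)%:R * p t +
    (2^-1 * alpha^-1 * (p t * p t) + - alpha^-1 * p t)) by exact: bmeasD.
have b1n : bmeas (fun _ : n.-tuple R => 1 : R) by exact: bmeas_cst.
rewrite /J (jointZ _ _ b1 n k _ b1n) (jointD _ _ b1 n _ _ bD b5').
rewrite (jointD _ _ b1 n _ _ b3' b4') (jointD _ _ b1 n _ _ b1' b2').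
rewrite (jointZ _ _ b1 n _ _ bpp) (jointZ _ _ b1 n _ _ bp).
move: Jpp J1 Jp; rewrite /J => Jpp -> ->.
(* The excess alpha^2 of the second moment costs alpha/2, on top of the alpha/2 of the pointwise
   inequality. *)
have : 2^-1 * alpha^-1 * J (fun t => p t * p t) <= 2^-1 * alpha^-1 * (1 + alpha ^+ 2).
  by rewrite ler_wpM2l// mulr_ge0// ltW.
have -> : 2^-1 * alpha^-1 * (1 + alpha ^+ 2) =
  2^-1 * alpha^-1 + 2^-1 * (alpha * alpha^-1) * alpha by ring.
rewrite aK /J /k; lra.
Qed.

End Mixture.

(** * Trigonometric orthogonality on the circle *)

Section Trig.
Variable R : realType.
Notation mu := (@lebesgue_measure R).
Notation I01 := (@I01 R).
Notation "''I' h" := (Rintegral mu I01 h) (at level 8).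

Definition cosz (z : int) (x : R) := cos (2 * pi * z%:~R * x).
Definition sinz (z : int) (x : R) := sin (2 * pi * z%:~R * x).

Lemma cosz0 x : cosz 0 x = 1.
Proof. by rewrite /cosz mulr0 mul0r cos0. Qed.

Lemma sinz0 x : sinz 0 x = 0.
Proof. by rewrite /sinz mulr0 mul0r sin0. Qed.

Lemma coszN z x : cosz (- z) x = cosz z x.
Proof. by rewrite /cosz rmorphN mulrN mulNr cosN. Qed.

Lemma sinzN z x : sinz (- z) x = - sinz z x.
Proof. by rewrite /sinz rmorphN mulrN mulNr sinN. Qed.

Lemma coszB z x y : cosz z (x - y) = cosz z x * cosz z y + sinz z x * sinz z y.
Proof. by rewrite /cosz mulrBr cosB. Qed.

Lemma coszD2 z w x : cosz (z + w) x = cosz z x * cosz w x - sinz z x * sinz w x.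
Proof. by rewrite /cosz /sinz -cosD intrD; congr cos; ring. Qed.

Lemma sinzD2 z w x : sinz (z + w) x = sinz z x * cosz w x + cosz z x * sinz w x.
Proof. by rewrite /cosz /sinz -sinD intrD; congr sin; ring. Qed.

Lemma cosz_cosz z w x : cosz z x * cosz w x = 2^-1 * (cosz (z + w) x + cosz (z - w) x).
Proof. by rewrite !coszD2 coszN sinzN; field. Qed.

Lemma sinz_sinz z w x : sinz z x * sinz w x = 2^-1 * (cosz (z - w) x + -1 * cosz (z + w) x).
Proof. by rewrite !coszD2 coszN sinzN; field. Qed.

Lemma sinz_cosz z w x : sinz z x * cosz w x = 2^-1 * (sinz (z + w) x + sinz (z - w) x).
Proof. by rewrite !sinzD2 coszN sinzN; field. Qed.

Lemma cos_2pi_shift (k : int) (a : R) : cos (a + 2 * pi * k%:~R) = cos a.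
Proof.
have aux (n : nat) (b : R) : cos (b + 2 * pi * n%:R) = cos b.
  by have <- := periodicn (@cosD2pi R) n b; congr cos; ring.
case: k => n; first exact: aux.
by rewrite NegzE -(aux n.+1 (a + _)); congr cos; rewrite rmorphN; ring.
Qed.

Lemma sin_2pi_shift (k : int) (a : R) : sin (a + 2 * pi * k%:~R) = sin a.
Proof.
have aux (n : nat) (b : R) : sin (b + 2 * pi * n%:R) = sin b.
  by have <- := periodicn (@sinD2pi R) n b; congr sin; ring.
case: k => n; first exact: aux.
by rewrite NegzE -(aux n.+1 (a + _)); congr sin; rewrite rmorphN; ring.
Qed.

(** Removes the fractional part from the circular convolution of trigonometric polynomials. *)
Lemma cosz_shift z (k : int) x : cosz z (x - k%:~R) = cosz z x.
Proof.
rewrite /cosz -[RHS](cos_2pi_shift (- (z * k))); congr cos.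
by rewrite rmorphN rmorphM; ring.
Qed.

Lemma continuous_cosz z : continuous (cosz z).
Proof.
move=> x; apply: continuous_comp; last exact: continuous_cos.
by apply: cvgM; [exact: cvg_cst|exact: cvg_id].
Qed.

Lemma continuous_sinz z : continuous (sinz z).
Proof.
move=> x; apply: continuous_comp; last exact: continuous_sin.
by apply: cvgM; [exact: cvg_cst|exact: cvg_id].
Qed.

Lemma bmeas_cosz z : bmeas (cosz z).
Proof.
split; last by exists 1 => x; exact: cos_max.
apply: continuous_measurable_fun; exact: continuous_cosz.
Qed.

Lemma bmeas_sinz z : bmeas (sinz z).
Proof.
split; last by exists 1 => x; exact: sin_max.
apply: continuous_measurable_fun; exact: continuous_sinz.
Qed.

Lemma int01_FTC (F f : R -> R) : bmeas f -> continuous f ->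
  (forall x : R, is_derive x 1 F (f x)) -> 'I f = F 1 - F 0.
Proof.
move=> bf cf dF; rewrite Rintegral_itv_bndo_bndc; last exact: bmeas_integrable.
rewrite /Rintegral (@continuous_FTC2 _ f F)//.
- exact: continuous_subspaceT.
- have cF x : {for x, continuous F}.
    by apply: differentiable_continuous; apply/derivable1_diffP; have [] := dF x.
  split; first by move=> x _; have [] := dF x.
  + by apply: cvg_at_right_filter; exact: cF.
  + by apply: cvg_at_left_filter; exact: cF.
- by move=> x _; rewrite derive1E; have [] := dF x.
Qed.

Lemma is_derive_scale (F : R -> R) (w x d : R) :
  is_derive x 1 F d -> is_derive x 1 (fun y : R => w * F y) (w * d).
Proof.
move=> dF.
have -> : (fun y : R => w * F y) = w \*: (F : R -> R^o) by [].
exact: is_deriveZ.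
Qed.

Lemma is_derive_comp_scale (F : R -> R) (w x d : R) :
  is_derive (w * x) 1 F d -> is_derive x 1 (fun y : R => F (w * y)) (w * d).
Proof.
move=> dF; rewrite mulrC; apply: (@is_derive1_comp _ F _ x) => //.
by rewrite -[X in is_derive _ _ _ X]mulr1; apply: is_derive_scale; exact: is_derive_id.
Qed.

Lemma twopiz_neq0 (z : int) : z != 0 -> 2 * pi * z%:~R != 0 :> R.
Proof. by move=> z0; rewrite !mulf_neq0 ?intr_eq0// ?gt_eqF// pi_gt0. Qed.

Lemma int01_cosz z : 'I (cosz z) = (z == 0)%:R.
Proof.
case: eqVneq => [->|z0].
  rewrite -[RHS](int01_cst R 1); apply: eq_Rintegral => x _; exact: cosz0.
pose w : R := 2 * pi * z%:~R.
have w0 : w != 0 by exact: twopiz_neq0.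
have dF (x : R) : is_derive x 1 (fun y => w^-1 * sinz z y) (cosz z x).
  rewrite -[X in is_derive _ _ _ X](mulKf w0); apply: is_derive_scale.
  by apply: is_derive_comp_scale; exact: is_derive_sin.
rewrite (int01_FTC _ _ (bmeas_cosz z) (@continuous_cosz z) dF).
by rewrite /sinz mulr0 sin0 mulr1 -[X in sin X]add0r sin_2pi_shift sin0 subrr.
Qed.

Lemma int01_sinz z : 'I (sinz z) = 0.
Proof.
have [->|z0] := eqVneq z 0.
  rewrite -[RHS](int01_cst R 0); apply: eq_Rintegral => x _; exact: sinz0.
pose w : R := 2 * pi * z%:~R.
have w0 : w != 0 by exact: twopiz_neq0.
have dF (x : R) : is_derive x 1 (fun y => - w^-1 * cosz z y) (sinz z x).
  rewrite -[X in is_derive _ _ _ X](mulKf w0) -[X in is_derive _ _ _ X]mulrNN -mulrN.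
  apply: is_derive_scale.
  by apply: is_derive_comp_scale; exact: is_derive_cos.
rewrite (int01_FTC _ _ (bmeas_sinz z) (@continuous_sinz z) dF).
by rewrite /cosz mulr0 cos0 mulr1 -[X in cos X]add0r cos_2pi_shift cos0 subrr.
Qed.

(** Frequencies are written i + 1 and j + 1, so their sum is never 0 and only the difference
    frequency can contribute. *)
Lemma int01_cosz_cosz (i j : nat) :
  'I (fun x => cosz (Posz i.+1) x * cosz (Posz j.+1) x) = 2^-1 * (i == j)%:R.
Proof.
under eq_Rintegral => x _ do rewrite cosz_cosz.
rewrite int01Z ?int01D ?int01_cosz; try exact: bmeas_cosz.
  by rewrite -PoszD addSn /= add0r subr_eq0 eqz_nat eqSS.
by apply: bmeasD; exact: bmeas_cosz.
Qed.

Lemma int01_sinz_sinz (i j : nat) :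
  'I (fun x => sinz (Posz i.+1) x * sinz (Posz j.+1) x) = 2^-1 * (i == j)%:R.
Proof.
under eq_Rintegral => x _ do rewrite sinz_sinz.
rewrite int01Z ?int01D ?int01Z ?int01_cosz; try exact: bmeas_cosz.
- by rewrite -PoszD addSn /= mulr0 addr0 subr_eq0 eqz_nat eqSS.
- by apply: bmeasZ; exact: bmeas_cosz.
by apply: bmeasD; [|apply: bmeasZ]; exact: bmeas_cosz.
Qed.

Lemma int01_sinz_cosz z w : 'I (fun x => sinz z x * cosz w x) = 0.
Proof.
under eq_Rintegral => x _ do rewrite sinz_cosz.
rewrite int01Z ?int01D ?int01_sinz; try exact: bmeas_sinz.
  by rewrite addr0 mulr0.
by apply: bmeasD; exact: bmeas_sinz.
Qed.

End Trig.
Arguments cosz {R}. Arguments sinz {R}.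

(** * Trigonometric perturbations of the uniform density *)

Section Model.
Variable R : realType.
Notation mu := (@lebesgue_measure R).
Notation I01 := (@I01 R).
Notation "''I' h" := (Rintegral mu I01 h) (at level 8).

(** A density is nonnegative only almost everywhere, so f and |f| are exchanged through
    almost-everywhere equality. *)
Lemma density_abs_integral (f : R -> R) : density f ->
  (\int[mu]_(x in I01) `|f x|%:E = 1)%E.
Proof.
move=> [[mf _] [f0 f1]]; rewrite -f1; apply: ae_eq_integral => //.
- exact: measurable_I01.
- by apply/measurable_EFinP; exact: measurableT_comp.
- exact/measurable_EFinP.
- move: f0; apply: filterS; first exact: (ae_filter_ringOfSetsType mu).
  by move=> x f0 Ix; rewrite ger0_norm// f0.
Qed.

Lemma density_integrable (f : R -> R) : density f -> mu.-integrable I01 (EFin \o f).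
Proof.
move=> df; apply/integrableP; split; first by apply/measurable_EFinP; case: df => -[].
by under eq_integral do rewrite /=; rewrite density_abs_integral// ltry.
Qed.

(** Parseval for a finite orthogonal system that is also orthogonal to constants. It serves the
    cosines, for the separation, and their convolutions with [phi], for the chi-square
    divergence. *)
Lemma int01_ortho (M : nat) (psi : nat -> R -> R) (c : nat -> R) (a b : R) (u v : nat -> R) :
  (forall j, bmeas (psi j)) -> (forall j, 'I (psi j) = 0) ->
  (forall j l, 'I (fun x => psi j x * psi l x) = c j * (j == l)%:R) ->
  'I (fun x => (a + \sum_(j < M) u j * psi j x) * (b + \sum_(j < M) v j * psi j x)) =
  a * b + \sum_(j < M) u j * v j * c j.
Proof.
move=> bp p0 pp.
have bs w : bmeas (fun x => \sum_(j < M) w j * psi j x).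
  by apply: bmeas_sum => j _; exact: bmeasZ.
have s0 w : 'I (fun x => \sum_(j < M) w j * psi j x) = 0.
  rewrite int01_sum; last by move=> j; exact: bmeasZ.
  by rewrite big1// => j _; rewrite int01Z// p0 mulr0.
have -> : (fun x => (a + \sum_(j < M) u j * psi j x) * (b + \sum_(j < M) v j * psi j x)) =
  fun x => (a * b + (a * (\sum_(j < M) v j * psi j x) + b * (\sum_(j < M) u j * psi j x))) +
   \sum_(j < M) \sum_(l < M) (u j * v l) * (psi j x * psi l x).
  apply/funext => x; set s := \sum_(j < M) u j * _; set t := \sum_(j < M) v j * _.
  rewrite (_ : \sum_(j < M) _ = s * t); first by ring.
  rewrite mulr_suml; apply: eq_bigr => j _; rewrite mulr_sumr.
  by apply: eq_bigr => l _; ring.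
have bb j l : bmeas (fun x => u j * v l * (psi j x * psi l x)).
  by apply: bmeasZ; exact: bmeasM.
rewrite int01D; last 2 first.
- apply: bmeasD; first exact: bmeas_cst.
  by apply: bmeasD; apply: bmeasZ; exact: bs.
- by apply: bmeas_sum => j _; apply: bmeas_sum => l _; exact: bb.
congr (_ + _).
  rewrite int01D; [|exact: bmeas_cst|by apply: bmeasD; apply: bmeasZ; exact: bs].
  rewrite int01D; [|by apply: bmeasZ; exact: bs..].
  by rewrite (int01Z _ a _ (bs v)) (int01Z _ b _ (bs u)) !s0 !mulr0 !addr0 int01_cst.
rewrite int01_sum; last by move=> j; apply: bmeas_sum => l _; exact: bb.
apply: eq_bigr => j _; rewrite int01_sum//.
rewrite (bigD1 j)//= big1 ?addr0 => [|l lj].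
  by rewrite int01Z ?pp ?eqxx ?mulr1//; exact: bmeasM.
rewrite int01Z ?pp; last exact: bmeasM.
have -> : (j == l :> nat) = false by rewrite eq_sym; exact/negbTE.
by rewrite !mulr0.
Qed.

(** * Convolution with the error density *)

Section Noise.
Variable phi : R -> R.
Hypothesis dphi : density phi.

Lemma integrable_bmeas_mul (b : R -> R) : bmeas b ->
  mu.-integrable I01 (EFin \o (fun s => b s * phi s)).
Proof.
move=> [mb [M bM]].
have M0 : 0 <= M by exact: le_trans (bM 0).
have := integrableZl (measurable_I01 R) M (density_integrable _ dphi).
apply: le_integrable; first exact: measurable_I01.
  apply/measurable_EFinP/measurable_funM; first exact: measurable_funTS.
  by case: dphi => -[].
by move=> x _; rewrite /= lee_fin !normrM ler_wpM2r// (ger0_norm M0).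
Qed.

(** Expectation under the error law. Since [phi] itself may be unbounded, linearity has to be proved
    afresh from the integrability of [phi]. *)
Definition Phi (b : R -> R) : R := 'I (fun s => b s * phi s).

Lemma PhiD a b : bmeas a -> bmeas b -> Phi (fun s => a s + b s) = Phi a + Phi b.
Proof.
move=> ba bb; rewrite /Phi -RintegralD; [|exact: measurable_I01|exact: integrable_bmeas_mul..].
by apply: eq_Rintegral => s _; rewrite mulrDl.
Qed.

Lemma PhiZ c b : bmeas b -> Phi (fun s => c * b s) = c * Phi b.
Proof.
move=> bb; rewrite /Phi -RintegralZl; [|exact: measurable_I01|exact: integrable_bmeas_mul].
by apply: eq_Rintegral => s _; rewrite mulrA.
Qed.

Lemma Phi1 : Phi (fun=> 1) = 1.
Proof.
rewrite /Phi; under eq_Rintegral do rewrite mul1r.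
by rewrite /Rintegral; case: dphi => _ [_ ->].
Qed.

Lemma Phi_sum (I : Type) (s : seq I) (F : I -> R -> R) : (forall i, bmeas (F i)) ->
  Phi (fun x => \sum_(i <- s) F i x) = \sum_(i <- s) Phi (F i).
Proof.
move=> bF; elim: s => [|i s IH].
  rewrite big_nil (_ : (fun _ => _) = fun=> 0 * 1).
    by rewrite PhiZ ?mul0r//; exact: bmeas_cst.
  by apply/funext => t; rewrite big_nil mul0r.
rewrite big_cons -IH -PhiD//; last exact: bmeas_sum.
by apply: (congr1 Phi); apply/funext => t; rewrite big_cons.
Qed.

Lemma Phi_bound b : bmeas b -> (forall x, `|b x| <= 1) -> `|Phi b| <= 1.
Proof.
move=> bb b1; rewrite -lee_fin /Phi EFin_normr_Rintegral; last 2 first.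
- exact: measurable_I01.
- exact: integrable_bmeas_mul.
have /integrableP[m _] := integrable_bmeas_mul _ bb.
rewrite (le_trans (le_abse_integral _ (measurable_I01 R) m))//.
rewrite -(density_abs_integral _ dphi); apply: ge0_le_integral.
- exact: measurable_I01.
- by move=> x _; exact: abse_ge0.
- exact: measurableT_comp.
- by apply/measurable_EFinP; apply: measurableT_comp => //; case: dphi => -[].
- by move=> x _; rewrite /= lee_fin normrM ler_piMl.
Qed.

Definition phic (j : nat) := Phi (cosz (Posz j.+1)).
Definition phis (j : nat) := Phi (sinz (Posz j.+1)).

Lemma fcoef_sqE j : fcoef_sq phi (Posz j.+1) = phic j ^+ 2 + phis j ^+ 2.
Proof.
by rewrite /fcoef_sq; congr (_ ^+ 2 + _ ^+ 2); apply: eq_Rintegral => x _; rewrite mulrC.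
Qed.

Lemma fcoef_sqN j : fcoef_sq phi (- Posz j.+1) = fcoef_sq phi (Posz j.+1).
Proof.
rewrite fcoef_sqE /fcoef_sq -(sqrrN (phis j)); congr (_ ^+ 2 + _ ^+ 2).
  by apply: eq_Rintegral => x _; rewrite -/(cosz _ x) coszN mulrC.
rewrite -mulN1r -PhiZ; last exact: bmeas_sinz.
apply: eq_Rintegral => x _.
by rewrite -/(sinz _ x) sinzN mulrC mulN1r.
Qed.

(** The cosine and sine parts are bounded separately. The factor 2 lost in this way is harmless in
    both uses: keeping inner products of alternatives nonnegative and keeping nu_k away from 0. *)
Lemma fcoef_sq_le2 j : fcoef_sq phi (Posz j.+1) <= 2.
Proof.
have c1 : `|phic j| <= 1.
  by apply: Phi_bound; [exact: bmeas_cosz|move=> x; exact: cos_max].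
have s1 : `|phis j| <= 1.
  by apply: Phi_bound; [exact: bmeas_sinz|move=> x; exact: sin_max].
rewrite fcoef_sqE -real_normK ?num_real// -[phis j ^+ 2]real_normK ?num_real//.
have := exprn_ile1 2 (normr_ge0 _) c1; have := exprn_ile1 2 (normr_ge0 _) s1; lra.
Qed.

(** The circular convolution of [cosz (j + 1)] with [phi]. *)
Definition psi j y : R := phic j * cosz (Posz j.+1) y + phis j * sinz (Posz j.+1) y.

Definition fpert M (u : nat -> R) x : R := 1 + \sum_(j < M) u j * cosz (Posz j.+1) x.
Definition gpert M (u : nat -> R) y : R := 1 + \sum_(j < M) u j * psi j y.

Lemma bmeas_psi j : bmeas (psi j).
Proof. by apply: bmeasD; apply: bmeasZ; [exact: bmeas_cosz|exact: bmeas_sinz]. Qed.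

Lemma bmeas_gpert M u : bmeas (gpert M u).
Proof.
apply: bmeasD; first exact: bmeas_cst.
by apply: bmeas_sum => j _; apply: bmeasZ; exact: bmeas_psi.
Qed.

Lemma bmeas_fpert M u : bmeas (fpert M u).
Proof.
apply: bmeasD; first exact: bmeas_cst.
by apply: bmeas_sum => j _; apply: bmeasZ; exact: bmeas_cosz.
Qed.

Lemma cconv_fpert M u y : cconv (fpert M u) phi y = gpert M u y.
Proof.
rewrite /cconv.
transitivity (Phi (fun s => 1 + \sum_(j < M) u j * (cosz (Posz j.+1) y * cosz (Posz j.+1) s +
  sinz (Posz j.+1) y * sinz (Posz j.+1) s))).
  apply: eq_Rintegral => s _; congr (_ * _); rewrite /fpert; congr (_ + _).
  by apply: eq_bigr => j _; rewrite cosz_shift coszB.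
have bc z : bmeas (@cosz R z) by exact: bmeas_cosz.
have bs z : bmeas (@sinz R z) by exact: bmeas_sinz.
have bt j : bmeas (fun s => cosz (Posz j.+1) y * cosz (Posz j.+1) s +
  sinz (Posz j.+1) y * sinz (Posz j.+1) s) by apply: bmeasD; exact: bmeasZ.
rewrite PhiD; [|exact: bmeas_cst|by apply: bmeas_sum => j _; exact: bmeasZ].
rewrite Phi1 /gpert; congr (_ + _); rewrite Phi_sum; last by move=> j; exact: bmeasZ.
apply: eq_bigr => j _; rewrite PhiZ// PhiD; [|exact: bmeasZ..].
by rewrite !PhiZ// /psi mulrC [_ * Phi _]mulrC [sinz _ _ * _]mulrC mulrC.
Qed.

Lemma I01_frac (x : R) : I01 (x - (Num.floor x)%:~R).
Proof. by rewrite /I01/= in_itv/= subr_ge0 ge_floor ltrBlDl -intrD1 floorD1_gt. Qed.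

Lemma cconv_fcirc y : cconv (@fcirc R) phi y = 1.
Proof.
rewrite -[RHS]Phi1; apply: eq_Rintegral => s _; congr (_ * _).
by rewrite /fcirc indicE mem_set//; exact: I01_frac.
Qed.

Lemma int01_psi j : 'I (psi j) = 0.
Proof.
have bc z : bmeas (@cosz R z) by exact: bmeas_cosz.
have bs z : bmeas (@sinz R z) by exact: bmeas_sinz.
rewrite int01D; [|exact: bmeasZ..].
by rewrite (int01Z _ _ _ (bc _)) (int01Z _ _ _ (bs _)) int01_cosz int01_sinz !mulr0 addr0.
Qed.

Lemma int01_psi_psi j l : 'I (fun x => psi j x * psi l x) =
  (2^-1 * fcoef_sq phi (Posz j.+1)) * (j == l)%:R.
Proof.
have bc z : bmeas (@cosz R z) by exact: bmeas_cosz.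
have bs z : bmeas (@sinz R z) by exact: bmeas_sinz.
have -> : (fun x => psi j x * psi l x) = fun x =>
  ((phic j * phic l) * (cosz (Posz j.+1) x * cosz (Posz l.+1) x) +
  (phis j * phis l) * (sinz (Posz j.+1) x * sinz (Posz l.+1) x)) +
  ((phis j * phic l) * (sinz (Posz j.+1) x * cosz (Posz l.+1) x) +
  (phic j * phis l) * (sinz (Posz l.+1) x * cosz (Posz j.+1) x)).
  by apply/funext => x; rewrite /psi; ring.
have bcc := bmeasM _ _ _ _ _ (bc (Posz j.+1)) (bc (Posz l.+1)).
have bss := bmeasM _ _ _ _ _ (bs (Posz j.+1)) (bs (Posz l.+1)).
have bsc := bmeasM _ _ _ _ _ (bs (Posz j.+1)) (bc (Posz l.+1)).
have bcs := bmeasM _ _ _ _ _ (bs (Posz l.+1)) (bc (Posz j.+1)).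
rewrite int01D; [|by apply: bmeasD; exact: bmeasZ..].
rewrite int01D; [|exact: bmeasZ..].
rewrite (int01Z _ _ _ bcc) (int01Z _ _ _ bss) int01_cosz_cosz int01_sinz_sinz.
rewrite int01D; [|exact: bmeasZ..].
rewrite (int01Z _ _ _ bsc) (int01Z _ _ _ bcs) !int01_sinz_cosz.
rewrite fcoef_sqE; case: eqVneq => [->|_]; last by rewrite !mulr0 !addr0.
by rewrite !mulr0 !addr0 !mulr1; ring.
Qed.

Lemma int01_gpert M u : 'I (gpert M u) = 1.
Proof.
rewrite int01D; [|exact: bmeas_cst|
  by apply: bmeas_sum => j _; apply: bmeasZ; exact: bmeas_psi].
rewrite int01_cst int01_sum ?big1 ?addr0// => j; last by apply: bmeasZ; exact: bmeas_psi.
by rewrite int01Z ?int01_psi ?mulr0//; exact: bmeas_psi.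
Qed.

Lemma int01_gpert_gpert M u v : 'I (fun x => gpert M u x * gpert M v x) =
  1 + 2^-1 * \sum_(j < M) u j * v j * fcoef_sq phi (Posz j.+1).
Proof.
rewrite (int01_ortho _ _ _ _ _ _ _ bmeas_psi int01_psi int01_psi_psi) mulr1.
by congr (_ + _); rewrite mulr_sumr; apply: eq_bigr => j _; ring.
Qed.

Lemma fpert_ge0 M (u : nat -> R) x : \sum_(j < M) `|u j| <= 1 -> 0 <= fpert M u x.
Proof.
move=> u1; rewrite /fpert -lerBlDl sub0r.
suff : `|\sum_(j < M) u j * cosz (Posz j.+1) x| <= 1 by rewrite ler_norml => /andP[].
rewrite (le_trans _ u1)// (le_trans (ler_norm_sum _ _ _))//.
by apply: ler_sum => j _; rewrite normrM ler_piMr//; exact: cos_max.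
Qed.

Lemma bmeas_inL2 (f : R -> R) : bmeas f -> inL2 f.
Proof.
move=> bf; split; first by case: bf => mf _; exact: measurable_funTS.
have /integrableP[_] := bmeas_integrable _ _ (bmeasM _ _ _ _ _ bf bf).
by under eq_integral => x _ do rewrite /= -expr2 ger0_norm ?sqr_ge0//.
Qed.

Lemma density_fpert M (u : nat -> R) : \sum_(j < M) `|u j| <= 1 -> density (fpert M u).
Proof.
move=> u1; have bf := bmeas_fpert M u.
split; first exact: bmeas_inL2.
split; first by apply: aeW => x _; exact: fpert_ge0.
have : 'I (fpert M u) = 1.
  rewrite int01D; [|exact: bmeas_cst|
    by apply: bmeas_sum => j _; apply: bmeasZ; exact: bmeas_cosz].
  rewrite int01_cst int01_sum ?big1 ?addr0// => j; last by apply: bmeasZ; exact: bmeas_cosz.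
  by rewrite int01Z ?int01_cosz ?mulr0//; exact: bmeas_cosz.
move=> <-; rewrite /Rintegral fineK//.
apply: integrable_fin_num; [exact: measurable_I01|exact: bmeas_integrable].
Qed.

Lemma fpert_diff M u x : I01 x ->
  (fpert M u \- @fcirc R) x = \sum_(j < M) u j * cosz (Posz j.+1) x.
Proof. by move=> Ix; rewrite /= /fcirc indicE mem_set//= /fpert addrAC subrr add0r. Qed.

Lemma inL2_fpert_diff M u : inL2 (fpert M u \- @fcirc R).
Proof.
apply: bmeas_inL2.
rewrite [X in bmeas X](_ : _ = fun x => fpert M u x + -1 * \1_I01 x).
  apply: bmeasD; first exact: bmeas_fpert.
  apply: bmeasZ; split; first by apply: measurable_indic; exact: measurable_I01.
  by exists 1 => x; rewrite indicE; case: (_ \in _); rewrite ?normr0 ?normr1.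
by apply/funext => x; rewrite mulN1r.
Qed.

Lemma L2norm_fpert_diff M u :
  L2norm (fpert M u \- @fcirc R) = Num.sqrt (2^-1 * \sum_(j < M) u j ^+ 2).
Proof.
rewrite /L2norm; congr Num.sqrt.
transitivity ('I (fun x => (0 + \sum_(j < M) u j * cosz (Posz j.+1) x) *
    (0 + \sum_(j < M) u j * cosz (Posz j.+1) x))).
  apply: eq_Rintegral => x; rewrite inE => Ix.
  by rewrite fpert_diff// !add0r -expr2.
rewrite (@int01_ortho _ (fun j => cosz (Posz j.+1)) (fun=> 2^-1)).
- by rewrite mul0r add0r mulr_sumr; apply: eq_bigr => j _; rewrite mulrC expr2.
- by move=> j; exact: bmeas_cosz.
- by move=> j; rewrite int01_cosz.
- by move=> j l; exact: int01_cosz_cosz.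
Qed.

Lemma fcoef_sq_fpert_diff M u l :
  fcoef_sq (fpert M u \- @fcirc R) (Posz l.+1) = if (l < M)%N then (2^-1 * u l) ^+ 2 else 0.
Proof.
have bc j : bmeas (fun x : R => u j * cosz (Posz j.+1) x) by apply: bmeasZ; exact: bmeas_cosz.
rewrite /fcoef_sq.
rewrite [X in _ + X ^+ 2](_ : _ = 0); last first.
  transitivity ('I (fun x => \sum_(j < M) u j * (sinz (Posz l.+1) x * cosz (Posz j.+1) x))).
    apply: eq_Rintegral => x; rewrite inE => Ix.
    rewrite fpert_diff// mulr_suml; apply: eq_bigr => j _.
    by rewrite -/(sinz _ x); ring.
  have bsc j : bmeas (fun x : R => sinz (Posz l.+1) x * cosz (Posz j.+1) x).
    by apply: bmeasM; [exact: bmeas_sinz|exact: bmeas_cosz].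
  rewrite int01_sum ?big1// => j; last exact: bmeasZ.
  by rewrite int01Z// int01_sinz_cosz mulr0.
rewrite expr0n addr0.
rewrite [X in X ^+ 2](_ : _ = if (l < M)%N then 2^-1 * u l else 0); last first.
  transitivity ('I (fun x => \sum_(j < M) u j * (cosz (Posz j.+1) x * cosz (Posz l.+1) x))).
    apply: eq_Rintegral => x; rewrite inE => Ix.
    rewrite fpert_diff// mulr_suml; apply: eq_bigr => j _.
    by rewrite -/(cosz _ x); ring.
  have bcc j : bmeas (fun x : R => cosz (Posz j.+1) x * cosz (Posz l.+1) x).
    by apply: bmeasM; exact: bmeas_cosz.
  rewrite int01_sum; last by move=> j; exact: bmeasZ.
  rewrite (eq_bigr (fun j : 'I_M => u j * (2^-1 * (j == l :> nat)%:R))); last first.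
    by move=> j _; rewrite int01Z// int01_cosz_cosz.
  case: ifPn => lM.
    rewrite (bigD1 (Ordinal lM))//= eqxx big1 ?addr0; first by rewrite mulr1 mulrC.
    by move=> j; rewrite -val_eqE/= => /negbTE ->; rewrite !mulr0.
  rewrite big1// => j _; case: eqP => [jl|]; last by rewrite !mulr0.
  by rewrite -jl ltn_ord in lM.
by case: ifP => // _; rewrite expr0n.
Qed.

End Noise.
End Model.

(** * Error probabilities are at most one *)

Section NoMeas.
Context d (T : measurableType d) (R : realType) (m : {measure set T -> \bar R}).

(** The integral of a nonnegative function is a supremum over the simple functions below it, hence
    monotone without measurability. This allows bounds on error probabilities for arbitrary
    densities, whose inner integrals are not known to be measurable. *)
Lemma ge0_le_integral_nomeas (D : set T) (f g : T -> \bar R) :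
  (forall x, D x -> (0 <= f x)%E) -> (forall x, D x -> (f x <= g x)%E) ->
  (\int[m]_(x in D) f x <= \int[m]_(x in D) g x)%E.
Proof.
move=> f0 fg; rewrite !(integral_mkcond D).
have h0 x : (0 <= (f \_ D) x)%E by exact: erestrict_ge0.
have hg x : ((f \_ D) x <= (g \_ D) x)%E.
  by rewrite !patchE; case: ifPn => // xD; apply: fg; exact: set_mem.
rewrite !ge0_integralTE// => [|x]; last exact: le_trans (h0 x) (hg x).
apply: le_ereal_sup => _ /= [h hf <-]; exists h => // x.
exact: le_trans (hf x) (hg x).
Qed.

(** The integrals of the positive and the negative part both lie in [0, 1], hence their difference
    lies in [-1, 1]. *)
Lemma Rintegral_norm_le1 (D : set T) (h : T -> R) :
  (\int[m]_(x in D) `|h x|%:E <= 1)%E -> `|Rintegral m D h| <= 1.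
Proof.
move=> h1; rewrite /Rintegral integralE.
set P := (\int[m]_(x in D) _)%E; set N := (\int[m]_(x in D) _)%E.
have P0 : (0 <= P)%E by apply: integral_ge0 => x _; exact: funepos_ge0.
have N0 : (0 <= N)%E by apply: integral_ge0 => x _; exact: funeneg_ge0.
have P1 : (P <= 1)%E.
  apply: le_trans h1; apply: ge0_le_integral_nomeas => x _; first exact: funepos_ge0.
  by rewrite funeposE -EFin_max lee_fin ge_max ler_norm normr_ge0.
have N1 : (N <= 1)%E.
  apply: le_trans h1; apply: ge0_le_integral_nomeas => x _; first exact: funeneg_ge0.
  by rewrite funenegE -EFinN -EFin_max lee_fin ge_max -normrN ler_norm normr_ge0.
move: P N P0 N0 P1 N1 => [p| |] [q| |]//.
rewrite !lee_fin => p0 q0 p1 q1; rewrite -EFinB/= ler_norml; lra.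
Qed.

End NoMeas.

(** * Rotations of the circle and the L^1 bound for convolutions *)

Section Shift.
Variable R : realType.
Notation mu := (@lebesgue_measure R).
Notation I01 := (@I01 R).

Lemma lebesgue_measure_shift (s : R) (A : set R) : measurable A ->
  pushforward mu ((fun x => x - s) : _ -> measurableTypeR R) A = mu A.
Proof.
move=> mA; apply/esym; apply: lebesgue_measure_unique mA.
  by apply: measurable_funB => //; exact: measurable_cst.
move=> ms _ [[a b]] _ <-; rewrite /= /pushforward.
rewrite (_ : _ @^-1` _ = `]a + s, b + s]%classic); last first.
  by apply/seteqP; split => x /=; rewrite !in_itv/= ltrBrDr lerBlDr.
rewrite !lebesgue_measure_itv/= !lte_fin ltrD2r; case: ifP => // _.
by rewrite -!EFinB; congr EFin; ring.
Qed.

Lemma integral_shift (s : R) (f : R -> \bar R) : measurable_fun setT f ->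
  (forall x, 0 <= f x)%E -> (\int[mu]_x f (x - s)%R = \int[mu]_x f x)%E.
Proof.
move=> mf f0.
have ms : measurable_fun setT ((fun x => x - s) : measurableTypeR R -> measurableTypeR R).
  by apply: measurable_funB => //; exact: measurable_cst.
transitivity (\int[pushforward mu ((fun x => x - s)%R : _ -> measurableTypeR R)]_x f x)%E.
  by rewrite ge0_integral_pushforward.
by apply: eq_measure_integral => A mA _; exact: lebesgue_measure_shift.
Qed.

Lemma measurable_shift (s : R) : measurable_fun setT (fun y : R => y - s).
Proof. by apply: measurable_funB => //; exact: measurable_cst. Qed.

Lemma measurable_reflect (s : R) : measurable_fun setT (fun y : R => s - y).
Proof. by apply: measurable_funB => //; exact: measurable_cst. Qed.

Lemma measurable_pairB : measurable_fun setT (fun z : R * R => z.1 - z.2).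
Proof. exact: measurable_funB. Qed.

Lemma I01E (x : R) : I01 x = (0 <= x < 1 : Prop).
Proof. by rewrite /I01 /= in_itv. Qed.

(** As y - s lies in (-1, 1), its floor is 0 or -1, and exactly one of y - s and y - s + 1 falls in
    I01. The rotation thus becomes a sum of two translations of the line. *)
Lemma I01_shift_sum (y s : R) : I01 y -> I01 s ->
  forall F : R -> R, F (y - s - (Num.floor (y - s))%:~R) =
   (F \_ I01) (y - s) + (F \_ I01) (y - (s - 1)).
Proof.
rewrite !I01E => /andP[y0 y1] /andP[s0 s1] F; rewrite !patchE.
have [sy|ys] := leP s y.
  rewrite (@floor_def _ _ 0) ?subr0; last by rewrite add0r; apply/andP; split; lra.
  rewrite (mem_set (_ : I01 (y - s))); last by rewrite I01E; apply/andP; split; lra.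
  rewrite (memNset (_ : ~ I01 (y - (s - 1)))) ?addr0//.
  by rewrite I01E => /andP[_]; lra.
rewrite (@floor_def _ _ (-1)); last by rewrite addNr mulr0z; apply/andP; split; lra.
rewrite (memNset (_ : ~ I01 (y - s))); last by rewrite I01E => /andP[+ _]; lra.
rewrite (mem_set (_ : I01 (y - (s - 1)))); last by rewrite I01E; apply/andP; split; lra.
by rewrite add0r; congr F; rewrite mulrN1z; ring.
Qed.

Lemma integral_circle_shift (F : R -> R) (s : R) : I01 s -> measurable_fun I01 F ->
  (forall x, 0 <= F x) ->
  (\int[mu]_(y in I01) (F (y - s - (Num.floor (y - s))%:~R))%:E =
   \int[mu]_(y in I01) (F y)%:E)%E.
Proof.
move=> Is mF F0.
have mI := measurable_I01 R.
have mFI : measurable_fun setT (F \_ I01) by apply/(measurable_restrictT _ mI).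
have F0' x : 0 <= (F \_ I01) x by rewrite patchE; case: ifP.
(* [ind s (y - s)] and [ind (s - 1) (y - (s - 1))] both encode that y lies in I01. After the
   translations, [ind s] and [ind (s - 1)] split [0, 1) at 1 - s, so each point is counted once. *)
pose ind (r : R) := (\1_I01 : R -> R) \o (fun y => y + r).
have mind r : measurable_fun setT (ind r).
  apply: measurableT_comp; first exact: measurable_indic.
  by apply: measurable_funD => //; exact: measurable_cst.
transitivity (\int[mu]_y (((F \_ I01) (y - s) * ind s (y - s))%:E +
   ((F \_ I01) (y - (s - 1)) * ind (s - 1) (y - (s - 1)))%:E))%E.
  rewrite integral_mkcond; apply: eq_integral => y _.
  rewrite /ind /= !subrK patchE indicE; case: ifPn => Iy; last by rewrite !mulr0 adde0.
  rewrite !mulr1 -EFinD; congr EFin; rewrite I01_shift_sum//.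
  by rewrite inE in Iy.
pose H r (z : R) := ((F \_ I01) z * ind r z)%:E.
have mH r : measurable_fun setT (H r) by apply/measurable_EFinP; exact: measurable_funM.
have H0 r z : (0 <= H r z)%E by rewrite lee_fin mulr_ge0// /ind /= indicE.
have mHs r (r' : R) : measurable_fun setT (fun y : R => H r (y - r')).
  exact: (measurableT_comp (mH r) (measurable_shift r')).
rewrite (@ge0_integralD _ _ _ mu setT measurableT (fun y => H s (y - s))
   (fun y => H (s - 1) (y - (s - 1))))//.
rewrite !integral_shift// -ge0_integralD//.
all: try solve [exact: mHs|exact: mH].
rewrite [RHS]integral_mkcond; apply: eq_integral => z _.
rewrite /H -EFinD -mulrDr !patchE; case: ifPn => Iz; last by rewrite mul0r.
move: Iz Is; rewrite inE !I01E => /andP[z0 z1] /andP[s0 s1].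
rewrite /ind /= !indicE.
have [h|h] := ltP (z + s) 1.
  rewrite (mem_set (_ : I01 (z + s))); last by rewrite I01E; apply/andP; split; lra.
  rewrite (memNset (_ : ~ I01 (z + (s - 1)))) ?addr0 ?mulr1//.
  by rewrite I01E => /andP[+ _]; lra.
rewrite (memNset (_ : ~ I01 (z + s))); last by rewrite I01E => /andP[_]; lra.
rewrite (mem_set (_ : I01 (z + (s - 1)))) ?add0r ?mulr1//.
by rewrite I01E; apply/andP; split; lra.
Qed.

(** Young's inequality in L^1: Tonelli and invariance under rotation. *)
Lemma cconv_L1 (f phi : R -> R) : density f -> density phi ->
  (\int[mu]_(y in I01) `|cconv f phi y|%:E <= 1)%E.
Proof.
move=> df dphi; have mI := measurable_I01 R.
have [[mf _] _] := df; have [[mp _] _] := dphi.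
pose af := (Num.norm \o f) \_ I01; pose ap := (Num.norm \o phi) \_ I01.
have maf : measurable_fun setT af.
  by apply/(measurable_restrictT _ mI); exact: measurableT_comp.
have map : measurable_fun setT ap.
  by apply/(measurable_restrictT _ mI); exact: measurableT_comp.
have af0 x : 0 <= af x by rewrite /af patchE; case: ifP => //= _; exact: normr_ge0.
have ap0 x : 0 <= ap x by rewrite /ap patchE; case: ifP => //= _; exact: normr_ge0.
(* Absolute integrand with the wrap-around unfolded into two translates of functions cut off outside
   I01; in this form it is jointly measurable. *)
pose G (z : R * R) := ((af (z.1 - z.2) + af (z.1 - (z.2 - 1))) * (ap z.2 * \1_I01 z.1))%:E.
have G0 z : (0 <= G z)%E.
  by rewrite lee_fin !mulr_ge0// ?addr_ge0// indicE.
have mG : measurable_fun setT G.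
  apply/measurable_EFinP; apply: measurable_funM; last apply: measurable_funM.
  - apply: measurable_funD.
      exact: (measurableT_comp maf measurable_pairB).
    have := measurableT_comp maf (measurableT_comp (measurable_shift (-1)) measurable_pairB).
    by apply: eq_measurable_fun => z _ /=; congr af; ring.
  - exact: (measurableT_comp map measurable_snd).
  - exact: (measurableT_comp (measurable_indic mI) measurable_fst).
have mf' : measurable_fun setT (f \_ I01) by apply/(measurable_restrictT _ mI).
apply: (@le_trans _ _ (\int[mu]_y \int[mu]_s G (y, s))%E).
  rewrite integral_mkcond; apply: ge0_le_integral_nomeas => y _.
    by apply: erestrict_ge0 => x _; rewrite lee_fin normr_ge0.
  rewrite patchE; case: ifPn => Iy; last by apply: integral_ge0 => s _; exact: G0.
  rewrite inE in Iy.
  (* [cconv] is a real-valued integral and [fine] sends infinite values to 0, so at this point only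
     an inequality is available. *)
  apply: (@le_trans _ _ `|\int[mu]_(s in I01) (f (y - s - (Num.floor (y - s))%:~R) * phi s)%:E|%E).
    rewrite /cconv /Rintegral; case: (\int[mu]_(s in I01) _)%E => [r| |]//=; exact: leey.
  apply: le_trans (le_abse_integral mu mI _) _.
    apply/measurable_EFinP; apply: measurable_funM => //.
    apply: (@eq_measurable_fun _ _ _ _ I01 (fun s => (f \_ I01) (y - s) + (f \_ I01) (y - (s - 1)))).
      by move=> s; rewrite inE => Is; rewrite I01_shift_sum.
    apply: measurable_funTS; apply: measurable_funD.
      exact: (measurableT_comp mf' (measurable_reflect y)).
    exact: (measurableT_comp mf' (measurableT_comp (measurable_reflect y) (measurable_shift 1))).
  rewrite integral_mkcond; apply: ge0_le_integral_nomeas => s _.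
    by apply: erestrict_ge0 => x _; exact: abse_ge0.
  rewrite patchE; case: ifPn => Is; last exact: G0.
  rewrite inE in Is; rewrite /G /= lee_fin normrM indicE mem_set// mulr1.
  rewrite -(I01_shift_sum _ _ Iy Is (Num.norm \o f)) /ap patchE mem_set//=.
(* For fixed s the inner integral over y is now |phi s| times the L^1 norm of a rotation of f, which
   is 1. *)
rewrite (@fubini_tonelli _ _ _ _ R mu mu G)//.
rewrite -(density_abs_integral _ _ dphi) [leRHS]integral_mkcond.
apply: ge0_le_integral_nomeas => s _; first by apply: integral_ge0 => y _; exact: G0.
rewrite patchE; case: ifPn => Is; last first.
  rewrite integral0_eq// => y _; rewrite /G /ap /= patchE (negbTE Is).
  by rewrite mul0r mulr0.
rewrite (_ : (\int[mu]_y G (y, s))%E = \int[mu]_(y in I01)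
    (ap s * `|f (y - s - (Num.floor (y - s))%:~R)|)%:E)%E; last first.
  rewrite [RHS]integral_mkcond; apply: eq_integral => y _; rewrite patchE /G /= indicE.
  case: ifPn => Iy; last by rewrite !mulr0.
  rewrite inE in Iy; rewrite inE in Is.
  by rewrite mulr1 mulrC -(I01_shift_sum _ _ Iy Is (Num.norm \o f)).
have mff : measurable_fun I01 (fun y => (`|f (y - s - (Num.floor (y - s))%:~R)|)%:E).
  apply: (@eq_measurable_fun _ _ _ _ I01 (fun y => (af (y - s) + af (y - (s - 1)))%:E)).
    by move=> y; rewrite !inE in Is * => Iy; rewrite -(I01_shift_sum _ _ Iy Is (Num.norm \o f)).
  apply: measurable_funTS; apply/measurable_EFinP/measurable_funD.
    exact: (measurableT_comp maf (measurable_shift s)).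
  exact: (measurableT_comp maf (measurable_shift (s - 1))).
under eq_integral do rewrite EFinM.
rewrite ge0_integralZl_EFin//.
have Is' : I01 s by rewrite inE in Is.
have mnf : measurable_fun I01 (Num.norm \o f) by exact: measurableT_comp.
rewrite (integral_circle_shift (Num.norm \o f) s Is' mnf) => [|x]; last exact: normr_ge0.
by rewrite /= (density_abs_integral _ _ df) mule1 /ap patchE Is.
Qed.

Lemma joint_norm_le1 (g : R -> R) n (F : n.-tuple R -> R) :
  (\int[mu]_(y in I01) `|g y|%:E <= 1)%E -> (forall t, `|F t| <= 1) ->
  `|joint_int g F| <= 1.
Proof.
move=> g1; elim: n F => [|n IH] F F1 /=; first exact: F1.
apply: Rintegral_norm_le1; apply: le_trans g1.
apply: ge0_le_integral_nomeas => y _; first by rewrite lee_fin.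
rewrite lee_fin normrM ler_piMr//; apply: IH => t; exact: F1.
Qed.

(* [sup] of an unbounded set is a junk value, so the risk is meaningful only once [Prob0]
   is bounded over all densities. *)
Lemma Prob0_le1 (f phi : R -> R) n (Delta : n.-tuple R -> bool) :
  density f -> density phi -> Prob0 phi f Delta <= 1.
Proof.
move=> df dphi; apply: le_trans (ler_norm _) _; apply: joint_norm_le1.
  exact: cconv_L1.
by move=> t; case: (Delta t); rewrite ?normr0 ?normr1.
Qed.

End Shift.

(** * Random signs on disjoint frequency blocks *)

Section Rademacher.
Variable R : realType.

(* For |y| <= 1/2 use exp(y) <= 1/(1 - y); otherwise |y| <= 2 y^2. *)
Lemma expR_add_expRN_le (y : R) : expR y + expR (- y) <= 2 * expR (2 * y ^+ 2).
Proof.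
have H (z : R) : `|z| <= 1/2 -> expR z + expR (- z) <= 2 * expR (2 * z ^+ 2).
  rewrite ler_norml => /andP[z1 z2].
  have inv (x : R) : x < 1 -> expR x <= (1 - x)^-1.
    move=> x1; rewrite -[expR x]invrK -expRN lef_pV2 ?posrE ?expR_gt0 ?subr_gt0//.
    exact: expR_ge1Dx.
  have h1 := inv z ltac:(lra); have h2 := inv (- z) ltac:(lra).
  have h3 := expR_ge1Dx (2 * z ^+ 2).
  apply: le_trans (lerD h1 h2) _.
  apply: (@le_trans _ _ (2 * (1 + 2 * z ^+ 2))); last by rewrite ler_wpM2l.
  have -> : (1 - z)^-1 + (1 - - z)^-1 = 2 / ((1 - z) * (1 + z)).
    by field; apply/andP; split; apply/eqP; lra.
  have zz : z ^+ 2 <= 1/4 by rewrite expr2; nra.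
  have z0 := sqr_ge0 z.
  have p0 : 0 < (1 - z) * (1 + z) by apply: mulr_gt0; lra.
  rewrite ler_pdivrMr//.
  have -> : (1 - z) * (1 + z) = 1 - z ^+ 2 by ring.
  nra.
have [|y1] := leP `|y| (1/2); first exact: H.
have yy : `|y| <= 2 * y ^+ 2 by rewrite -(real_normK (num_real y)) expr2; nra.
have h1 : expR y <= expR (2 * y ^+ 2) by rewrite ler_expR (le_trans (ler_norm _)).
have h2 : expR (- y) <= expR (2 * y ^+ 2).
  by rewrite ler_expR (le_trans (ler_norm _))// normrN.
lra.
Qed.

(** The exponential of the sum factorises over the coordinates, so the sum over sign vectors is a
    product of two-term sums. The reference signs [r], those of the other alternative, drop out
    because the bound depends on squares only. *)
Lemma sum_signs_le (M : nat) (t : nat -> R) (r : nat -> bool) :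
  \sum_(e : {ffun 'I_M -> bool}) expR (\sum_(j < M) t j * (-1) ^+ (r j) * (-1) ^+ (e j))
  <= 2 ^+ M * expR (2 * \sum_(j < M) t j ^+ 2).
Proof.
pose F (j : 'I_M) (b : bool) := expR (t j * (-1) ^+ (r j) * (-1) ^+ b).
rewrite (eq_bigr (fun e : {ffun 'I_M -> bool} => \prod_(j < M) F j (e j))); last first.
  by move=> e _; rewrite expR_sum.
rewrite -(bigA_distr_bigA F) mulr_sumr expR_sum.
have -> : 2 ^+ M = \prod_(j < M) 2 :> R by rewrite prodr_const card_ord.
rewrite -big_split/=; apply: ler_prod => j _; apply/andP; split.
  by apply: sumr_ge0 => b _; exact: expR_ge0.
rewrite big_bool /F /= expr0 expr1 mulr1 mulrN1.
have -> : t j ^+ 2 = (t j * (-1) ^+ (r j)) ^+ 2 by rewrite exprMn sqrr_sign mulr1.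
by rewrite addrC; exact: expR_add_expRN_le.
Qed.

End Rademacher.

(** * Chi-square divergence of the block mixture *)

Section Chi2.
Variables (R : realType) (phi : R -> R).
Hypothesis dphi : density phi.
Notation mu := (@lebesgue_measure R).
Notation I01 := (@I01 R).
Notation "''I' h" := (Rintegral mu I01 h) (at level 8).
Variables (N M n : nat) (b : 'I_N -> nat -> R) (E : R).
Hypothesis b_disj : forall i l j, i != l -> b i j * b l j = 0.
Hypothesis b_sum : forall i, \sum_(j < M) `|b i j| <= 1.
(** With t_j = n b_j^2 |phi_(j+1)|^2 / 2, the exponent 2 sum t_j^2 of the sign average is half of
    this left-hand side, hence the factor 2 before [E]. *)
Hypothesis bE : forall i,
  n%:R ^+ 2 * (\sum_(j < M) b i j ^+ 4 * fcoef_sq phi (Posz j.+1) ^+ 2) <= 2 * E.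

(** The signs need a finite index type, while coefficient sequences are indexed by [nat]; indices
    from M on receive the sign +. *)
Definition ext_sign (e : {ffun 'I_M -> bool}) (j : nat) : bool := oapp e false (insub j).

Lemma ext_signE e (j : 'I_M) : ext_sign e j = e j.
Proof. by rewrite /ext_sign valK. Qed.

Definition coef (w : 'I_N * {ffun 'I_M -> bool}) (j : nat) : R :=
  b w.1 j * (-1) ^+ (ext_sign w.2 j).

Lemma coef_norm w j : `|coef w j| = `|b w.1 j|.
Proof. by rewrite normrM normrX normrN1 expr1n mulr1. Qed.

Lemma coef_sq w j : coef w j ^+ 2 = b w.1 j ^+ 2.
Proof. by rewrite exprMn sqrr_sign mulr1. Qed.

Lemma coef_abs_sum w : \sum_(j < M) `|coef w j| <= 1.
Proof. by under eq_bigr do rewrite coef_norm; exact: b_sum. Qed.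

Let h w := gpert R phi M (coef w).

Lemma cross_eq1 w w' : w.1 != w'.1 -> 'I (fun y => h w y * h w' y) = 1.
Proof.
move=> ww; rewrite int01_gpert_gpert big1 ?mulr0 ?addr0// => j _.
by rewrite /coef mulrACA b_disj// !mul0r.
Qed.

Lemma diag_le i (e : {ffun 'I_M -> bool}) :
  \sum_(e' : {ffun 'I_M -> bool}) ('I (fun y => h (i, e) y * h (i, e') y)) ^+ n
    <= 2 ^+ M * expR E.
Proof.
pose q j := fcoef_sq phi (Posz j.+1).
have q0 j : 0 <= q j by rewrite addr_ge0 ?sqr_ge0.
pose t j := n%:R * (2^-1 * (b i j ^+ 2 * q j)).
have tE : 2 * \sum_(j < M) t j ^+ 2 <= E.
  have -> : \sum_(j < M) t j ^+ 2 =
      4^-1 * (n%:R ^+ 2 * (\sum_(j < M) b i j ^+ 4 * q j ^+ 2)).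
    by rewrite !mulr_sumr; apply: eq_bigr => j _; rewrite /t; field.
  by have := bE i; rewrite -/q; lra.
apply: (@le_trans _ _ (2 ^+ M * expR (2 * \sum_(j < M) t j ^+ 2))); last first.
  by rewrite ler_wpM2l ?exprn_ge0// ler_expR.
apply: le_trans (sum_signs_le _ _ t (ext_sign e)).
apply: ler_sum => e' _; rewrite int01_gpert_gpert.
set S := 2^-1 * _.
(* Raising 1 + S <= exp S to the n-th power requires 1 + S >= 0. *)
have S1 : -1 <= S.
  suff : `|S| <= 1 by rewrite ler_norml => /andP[].
  rewrite /S normrM ger0_norm//.
  suff : `|\sum_(j < M) coef (i, e) j * coef (i, e') j * q j| <= 2 by rewrite -/q; lra.
  rewrite (le_trans (ler_norm_sum _ _ _))//.
  apply: (@le_trans _ _ (\sum_(j < M) 2 * `|b i j|)); last first.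
    by rewrite -mulr_sumr; have := b_sum i; lra.
  apply: ler_sum => j _; rewrite (normrM (_ * _)) (normrM (coef _ _)) !coef_norm /=.
  have bj1 : `|b i j| <= 1.
    apply: le_trans (b_sum i); rewrite (bigD1 j)//= lerDl; exact: sumr_ge0.
  have q2 : `|q j| <= 2 by rewrite ger0_norm// (fcoef_sq_le2 _ _ dphi).
  rewrite mulrC ler_pM// ?mulr_ge0// ler_piMr//.
apply: (@le_trans _ _ (expR S ^+ n)).
  by rewrite lerXn2r ?nnegrE ?expR_ge0 ?expR_ge1Dx//; lra.
rewrite -expRM_natl ler_expR /S !mulr_sumr; apply: ler_sum => j _.
by rewrite /coef /= !ext_signE /t /q; rewrite le_eqVlt; apply/orP; left; apply/eqP; ring.
Qed.

(** For fixed [w], each foreign block contributes exactly 1 per sign vector and the own block at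
    most 2^M exp E; the N - 1 foreign blocks are counted as N. *)
Lemma chi2_le : (0 < N)%N ->
  \sum_w \sum_w' ('I (fun y => h w y * h w' y)) ^+ n
   <= (1 + expR E / N%:R) * (#|{: 'I_N * {ffun 'I_M -> bool}}|%:R) ^+ 2.
Proof.
move=> N0.
have -> : #|{: 'I_N * {ffun 'I_M -> bool}}|%:R = N%:R * 2 ^+ M :> R.
  by rewrite card_prod card_ord card_ffun card_bool card_ord natrM natrX.
apply: (@le_trans _ _ (\sum_(w : 'I_N * {ffun 'I_M -> bool}) ((N%:R + expR E) * 2 ^+ M))).
  apply: ler_sum => -[i e] _.
  rewrite (_ : \sum_w' _ = \sum_(l < N) \sum_(e' : {ffun 'I_M -> bool})
     ('I (fun y => h (i, e) y * h (l, e') y)) ^+ n); last by rewrite pair_bigA; apply: eq_bigr => -[].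
  rewrite (bigD1 i)//= addrC mulrDl; apply: lerD; last by rewrite mulrC; exact: diag_le.
  apply: (@le_trans _ _ (\sum_(l < N | l != i) 2 ^+ M)).
    apply: ler_sum => l li; rewrite (eq_bigr (fun=> 1)); last first.
      by move=> e' _; rewrite cross_eq1 ?expr1n// eq_sym.
    by rewrite sumr_const card_ffun card_bool card_ord natrX.
  apply: (@le_trans _ _ (\sum_(l < N) 2 ^+ M)).
    by rewrite [leRHS](bigD1 i)//= lerDr exprn_ge0.
  by rewrite sumr_const card_ord mulr_natl.
rewrite sumr_const card_prod card_ord card_ffun card_bool card_ord -[leLHS]mulr_natl natrM natrX.
rewrite le_eqVlt; apply/orP; left; apply/eqP; field.
by rewrite pnatr_eq0 -lt0n.
Qed.

(** A bound on the average over the mixture holds for at least one component. Which component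
    depends on [Delta], and its block will determine the sequence a for which the risk is large. *)
Lemma testing_lower_bound (alpha : R) (Delta : n.-tuple R -> bool) :
  measurable (Delta @^-1` [set true]) -> 0 < alpha -> (0 < N)%N ->
  expR E / N%:R <= alpha ^+ 2 ->
  exists w, 1 - alpha <= Prob1 phi (@fcirc R) Delta + Prob0 phi (fpert R M (coef w)) Delta.
Proof.
move=> mD a0 N0 EN.
set W := ('I_N * {ffun 'I_M -> bool})%type.
have W0 : (0 < #|{: W}|)%N by rewrite card_prod card_ord card_ffun card_bool muln_gt0 N0 expn_gt0.
have chi : \sum_w \sum_w' ('I (fun y => h w y * h w' y)) ^+ n
    <= (1 + alpha ^+ 2) * #|{: W}|%:R ^+ 2.
  apply: le_trans (chi2_le N0) _.
  by rewrite ler_wpM2r ?sqr_ge0// lerD2l.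
have := mixture_error_ge R W h n Delta alpha mD a0 W0
  (fun w => bmeas_gpert _ _ _ _) (fun w => int01_gpert _ _ _ _) chi.
rewrite (_ : joint_int (fun=> 1) _ = Prob1 phi (@fcirc R) Delta); last first.
  rewrite /Prob1 (_ : cconv (@fcirc R) phi = fun=> 1)//.
  by apply/funext => y; rewrite (cconv_fcirc _ _ dphi).
rewrite (eq_bigr (fun w => Prob0 phi (fpert R M (coef w)) Delta)); last first.
  move=> w _; rewrite /Prob0 (_ : cconv (fpert R M (coef w)) phi = h w)//.
  by apply/funext => y; rewrite (cconv_fpert R phi dphi).
move=> key; apply: contrapT => /forallNP nw.
suff : #|{: W}|%:R^-1 * \sum_(w : W) Prob0 phi (fpert R M (coef w)) Delta
     < 1 - alpha - Prob1 phi (@fcirc R) Delta by lra.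
rewrite ltr_pdivrMl ?ltr0n//.
apply: (@lt_le_trans _ _ (\sum_(w : W) (1 - alpha - Prob1 phi (@fcirc R) Delta))).
  have [w0 _] : exists w0 : W, w0 \in [set: W]%SET.
    by move/card_gt0P : W0 => [w0 _]; exists w0; rewrite inE.
  have lt w : Prob0 phi (fpert R M (coef w)) Delta < 1 - alpha - Prob1 phi (@fcirc R) Delta.
    by have /negP := nw w; rewrite -ltNge; lra.
  rewrite (bigD1 w0)//= [ltRHS](bigD1 w0)//=; apply: ltr_leD => //.
  by apply: ler_sum => w _; exact/ltW.
by rewrite sumr_const mulr_natl.
Qed.

End Chi2.

(** * Reduction at a fixed sample size *)

Section Block.
Variable R : realType.

(** Index j stands for frequency j + 1, so the block consists of the frequencies in (h, 2h], with
    top frequency k = 2h. *)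
Definition inblock (h j : nat) : bool := (h <= j < 2 * h)%N.

Lemma sum_block (h M : nat) (c : R) : (2 * h <= M)%N ->
  \sum_(j < M) (if inblock h j then c else 0) = h%:R * c.
Proof.
move=> hM; rewrite -big_mkcond /inblock.
rewrite (eq_bigl (fun j : 'I_M => (true && (h <= j)%N) && (j < 2 * h)%N))//.
rewrite -(@big_ord_widen_cond _ _ _ (2 * h) M (fun j => true && (h <= j)%N) (fun=> c))//.
rewrite -(big_geq_mkord h (2 * h) xpredT (fun=> c)) sumr_const_nat.
by rewrite mulr_natl; congr (_ *+ _); lia.
Qed.

Lemma sum_block_le (h M : nat) (c : R) : 0 <= c ->
  \sum_(j < M) (if inblock h j then c else 0) <= h%:R * c.
Proof.
move=> c0; rewrite -(@sum_block h (M + 2 * h) c) ?leq_addl// big_split_ord/= lerDl.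
by apply: sumr_ge0 => j _; case: ifP.
Qed.

End Block.

(** * Elementary bounds on the risk *)

Section Risk.
Variables (R : realType) (phi : R -> R).
Hypothesis dphi : density phi.
Notation mu := (@lebesgue_measure R).

Lemma Prob1_fcirc_le1 n (Delta : n.-tuple R -> bool) : Prob1 phi (@fcirc R) Delta <= 1.
Proof.
apply: le_trans (ler_norm _) _; apply: joint_norm_le1; last first.
  by move=> t; case: (Delta t); rewrite ?normr0 ?normr1.
under eq_integral do rewrite (cconv_fcirc _ _ dphi) normr1.
by rewrite integral_cst ?mul1e ?[X in (X <= _)%E](mu_I01 R)//; exact: measurable_I01.
Qed.

Lemma Prob0_set_ub n (Delta : n.-tuple R -> bool) (P : (R -> R) -> Prop) :
  ubound [set Prob0 phi f Delta | f in [set f | density f /\ P f]] 1.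
Proof. by move=> _ [f [df _] <-]; exact: Prob0_le1. Qed.

(** A uniform bound makes the supremum over the sequences a in the conclusion a genuine least upper
    bound. *)
Lemma risk_le2 n (Delta : n.-tuple R -> bool) E r : risk phi Delta E r <= 2.
Proof.
rewrite /risk (_ : 2 = 1 + 1)//; apply: lerD; first exact: Prob1_fcirc_le1.
set S := [set Prob0 phi f Delta | f in _].
(* Without alternatives, [sup] takes its default value 0. *)
have [->|/set0P S0] := eqVneq S set0; first by rewrite sup0.
apply: ge_sup => //; exact: Prob0_set_ub.
Qed.

Lemma risk_ge n (Delta : n.-tuple R -> bool) (E : (R -> R) -> Prop) r (f : R -> R) :
  density f -> E (f \- @fcirc R) -> r <= L2norm (f \- @fcirc R) ->
  Prob1 phi (@fcirc R) Delta + Prob0 phi f Delta <= risk phi Delta E r.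
Proof.
move=> df Ef rf; rewrite /risk lerD2l; apply: ub_le_sup.
  by exists 1; exact: Prob0_set_ub.
by exists f.
Qed.

End Risk.

(** * Block amplitudes: energy, separation and smoothness *)

Section Core.
Variables (R : realType) (phi : R -> R) (c C p : R).
Hypothesis dphi : density phi.
Hypothesis phi0 : forall j : int, 0 < fcoef_abs phi j.
Hypothesis c0 : 0 < c.
Hypothesis cC : c <= C.
Hypothesis p0 : 0 < p.
Hypothesis decay : forall j : nat, (0 < j)%N ->
  c * (j%:R `^ (- p)) <= fcoef_abs phi (Posz j) <= C * (j%:R `^ (- p)).

Lemma fcoef_abs2 (j : int) : fcoef_abs phi j ^+ 2 = fcoef_sq phi j.
Proof. by rewrite sqr_sqrtr// addr_ge0// sqr_ge0. Qed.

Lemma fcoef_absN j : fcoef_abs phi (- Posz j.+1) = fcoef_abs phi (Posz j.+1).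
Proof. by rewrite /fcoef_abs (fcoef_sqN _ _ dphi). Qed.

Definition nu4 k : R := \sum_(i < k) 2 * fcoef_abs phi (Posz i.+1) ^- 4.

Lemma nu4E k : nu phi k ^+ 4 = nu4 k.
Proof.
have S0 : 0 <= nu4 k.
  by apply: sumr_ge0 => i _; rewrite mulr_ge0// invr_ge0 exprn_ge0// ltW.
rewrite /nu (eq_bigr (fun i : 'I_k => 2 * fcoef_abs phi (Posz i.+1) ^- 4)); last first.
  by move=> i _; rewrite fcoef_absN -mulr2n mulr_natl.
rewrite -/(nu4 k) -powR_mulrn ?powR_ge0// -powRrM mulVf ?powRr1//.
Qed.

Lemma nu4_le k : nu4 k <= 2 * k%:R * (k%:R `^ p / c) ^+ 4.
Proof.
apply: (@le_trans _ _ (\sum_(i < k) 2 * (k%:R `^ p / c) ^+ 4)); last first.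
  by rewrite sumr_const card_ord -[leLHS]mulr_natl mulrCA mulrA.
apply: ler_sum => i _; rewrite ler_wpM2l// -exprVn; apply: lerXn2r; rewrite ?nnegrE.
- by rewrite invr_ge0 ltW.
- by rewrite divr_ge0 ?powR_ge0// ltW.
have /andP[d1 _] := decay i.+1 isT.
have i0 : 0 < i.+1%:R `^ p :> R by apply: powR_gt0; rewrite ltr0n.
have k0 : 0 < k%:R `^ p :> R by apply: powR_gt0; rewrite ltr0n; exact: leq_ltn_trans (ltn_ord i).
rewrite -[leRHS]invrK lef_pV2 ?posrE ?phi0//; last by rewrite invr_gt0 divr_gt0.
apply: le_trans d1; rewrite invf_div; apply: ler_wpM2l; first exact: ltW.
rewrite powRN lef_pV2 ?posrE//.
by apply: ge0_ler_powR; rewrite ?nnegrE ?ler0n ?ler_nat//; exact/ltW.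
Qed.

(** The first frequency suffices, as |phi_1|^2 <= 2. The bound keeps nu_k^2 / x positive and, later,
    the exponent s from being too large. *)
Lemma nu2_ge k : (0 < k)%N -> 2^-1 <= nu phi k ^+ 2.
Proof.
move=> k0; have : 4^-1 <= nu phi k ^+ 4.
  rewrite nu4E /nu4; case: k k0 => // k _; rewrite big_ord_recl.
  apply: (@le_trans _ _ (2 * fcoef_abs phi 1 ^- 4)); last first.
    rewrite lerDl; apply: sumr_ge0 => i _.
    by rewrite mulr_ge0// invr_ge0 exprn_ge0// ltW.
  have q2 := fcoef_sq_le2 _ _ dphi 0; have q0 := phi0 1.
  have : fcoef_abs phi 1 ^+ 4 <= 4.
    rewrite (exprM _ 2 2) fcoef_abs2 -[4]/((2 * 2)%:R) natrM -expr2.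
    by apply: lerXn2r => //; rewrite nnegrE// -fcoef_abs2 sqr_ge0.
  move=> f4; have : 4^-1 <= fcoef_abs phi 1 ^- 4 by rewrite lef_pV2 ?posrE ?exprn_gt0.
  lra.
rewrite (exprM _ 2 2) => n4; rewrite leNgt; apply/negP => n2.
have := sqr_ge0 (nu phi k); nra.
Qed.

Variables (x Ab : R).
Hypotheses (x0 : 0 < x) (Ab0 : 0 < Ab).

(** The factor 2 compensates the squared norm 1/2 of each of the h cosines in the block. *)
Definition tau (h : nat) : R := Num.sqrt (2 * Ab ^+ 2 * nu phi (2 * h) ^+ 2 / (x * h%:R)).
Definition amp (h j : nat) : R := if inblock h j then tau h else 0.

Lemma tau_ge0 h : 0 <= tau h. Proof. exact: sqrtr_ge0. Qed.

Lemma tau_sq h : (0 < h)%N -> h%:R * tau h ^+ 2 = 2 * Ab ^+ 2 * (nu phi (2 * h) ^+ 2 / x).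
Proof.
move=> h0; have hR : h%:R != 0 :> R by rewrite pnatr_eq0 -lt0n.
rewrite sqr_sqrtr; last first.
  have := ltW x0; have := sqr_ge0 Ab; have := sqr_ge0 (nu phi (2 * h)) => n2 a2 x2.
  by apply: divr_ge0; repeat apply: mulr_ge0 => //.
by field; rewrite hR gt_eqF.
Qed.

Lemma amp_sum h M : (0 < h)%N -> Ab ^+ 2 * (nu phi (2 * h) ^+ 2 * (2 * h)%:R) <= x ->
  \sum_(j < M) `|amp h j| <= 1.
Proof.
move=> h0 hx.
rewrite (eq_bigr (fun j : 'I_M => if inblock h j then tau h else 0)); last first.
  by move=> j _; rewrite ger0_norm// /amp; case: ifP => // _; exact: tau_ge0.
apply: le_trans (sum_block_le _ _ _ _ (tau_ge0 h)) _.
rewrite -(@ler_pXn2r _ 2)// ?nnegrE ?mulr_ge0 ?tau_ge0//.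
rewrite exprMn expr1n expr2 -mulrA tau_sq//.
have -> : h%:R * (2 * Ab ^+ 2 * (nu phi (2 * h) ^+ 2 / x)) =
  Ab ^+ 2 * (nu phi (2 * h) ^+ 2 * (2 * h)%:R) / x by rewrite natrM; ring.
by rewrite ler_pdivrMr// mul1r.
Qed.

(* The energy [n^2 h tau^4 max q^2] of a block is bounded by [Kc Ab^4 (n/x)^2] via
   [nu (2h)^4 <= 4h ((2h)^p / c)^4] and [q_j <= (C h^(-p))^2]. *)
Definition Kc : R := 16 * (2 `^ p * C / c) ^+ 4.

Lemma amp_energy (n h M : nat) : (0 < h)%N ->
  n%:R ^+ 2 * (\sum_(j < M) amp h j ^+ 4 * fcoef_sq phi (Posz j.+1) ^+ 2)
   <= Kc * Ab ^+ 4 * (n%:R / x) ^+ 2.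
Proof.
move=> h0; have hR : 0 < h%:R :> R by rewrite ltr0n.
pose P : R := h%:R `^ p; have P0 : 0 < P by rewrite powR_gt0.
have C0 : 0 < C by exact: lt_le_trans cC.
apply: (@le_trans _ _ (n%:R ^+ 2 * (h%:R * (tau h ^+ 4 * (C / P) ^+ 4)))).
  rewrite ler_wpM2l ?sqr_ge0//.
  have t0 : 0 <= tau h ^+ 4 * (C / P) ^+ 4.
    by rewrite mulr_ge0 ?exprn_ge0 ?tau_ge0// divr_ge0// ltW.
  apply: le_trans (sum_block_le _ _ M _ t0); apply: ler_sum => j _.
  rewrite /amp /inblock; case: ifPn => [/andP[hj _]|_]; last by rewrite expr0n mul0r.
  rewrite ler_wpM2l ?exprn_ge0 ?tau_ge0//.
  rewrite -fcoef_abs2 -exprM; apply: lerXn2r;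
    rewrite ?nnegrE; [exact/ltW|by rewrite divr_ge0 ?ltW|].
  have /andP[_ d2] := decay j.+1 isT; apply: le_trans d2 _.
  apply: ler_wpM2l; first exact: ltW.
  rewrite powRN lef_pV2 ?posrE ?powR_gt0 ?ltr0n//.
  by apply: ge0_ler_powR; rewrite ?nnegrE ?ler0n ?ler_nat//; [exact/ltW|exact: leqW].
have -> : n%:R ^+ 2 * (h%:R * (tau h ^+ 4 * (C / P) ^+ 4)) =
   4 * Ab ^+ 4 * (n%:R / x) ^+ 2 / h%:R * (C / P) ^+ 4 * nu4 (2 * h).
  have -> : h%:R * (tau h ^+ 4 * (C / P) ^+ 4) =
     (h%:R * tau h ^+ 2) ^+ 2 / h%:R * (C / P) ^+ 4 by field; rewrite gt_eqF//= gt_eqF.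
  rewrite tau_sq// -nu4E; field; rewrite !gt_eqF//.
have h1 := nu4_le (2 * h).
have : 4 * Ab ^+ 4 * (n%:R / x) ^+ 2 / h%:R * (C / P) ^+ 4 * nu4 (2 * h) <=
  4 * Ab ^+ 4 * (n%:R / x) ^+ 2 / h%:R * (C / P) ^+ 4 *
  (2 * (2 * h)%:R * ((2 * h)%:R `^ p / c) ^+ 4).
  rewrite ler_wpM2l// !mulr_ge0// ?exprn_ge0 ?divr_ge0 ?invr_ge0 ?ler0n// ltW//.
move=> h2; apply: le_trans h2 _.
rewrite natrM powRM ?ler0n// -/P /Kc.
rewrite le_eqVlt; apply/orP; left; apply/eqP; field.
by rewrite !gt_eqF.
Qed.

Lemma amp_sq h j : amp h j ^+ 2 = if inblock h j then tau h ^+ 2 else 0.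
Proof. by rewrite /amp; case: ifP => // _; rewrite expr0n. Qed.

Lemma amp_disjoint (m i l j : nat) : i != l -> amp (2 ^ (m + i)) j * amp (2 ^ (m + l)) j = 0.
Proof.
wlog il : i l / (i < l)%N => [H|_].
  rewrite neq_ltn => /orP[il|li]; first by rewrite H// ltn_eqF.
  by rewrite mulrC H// ltn_eqF.
rewrite /amp /inblock; case: ifP => [/andP[_ h1]|]; last by rewrite mul0r.
case: ifP => [/andP[h2 _]|]; last by rewrite mulr0.
have : (2 ^ (m + i).+1 <= 2 ^ (m + l))%N by rewrite leq_exp2l// -addnS leq_add2l.
by rewrite expnS => h3; have := leq_trans h1 (leq_trans h3 h2); rewrite ltnn.
Qed.

Lemma rho_le (a : nat -> R) k : (0 < k)%N ->
  rho phi a x <= Num.sqrt (Num.max (a k ^+ 2) (nu phi k ^+ 2 / x)).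
Proof.
move=> k0; apply: ler_wsqrtr; apply: ge_inf; last by exists k.
exists 0 => _ [l _ <-]; rewrite le_max; apply/orP; left; exact: sqr_ge0.
Qed.

Definition expseq (s : R) (j : nat) : R := expR (- (j%:R `^ s)).

Lemma expseq_inv_le (s : R) (j k : nat) : 0 <= s -> (j <= k)%N ->
  expseq s j ^- 2 <= expseq s k ^- 2.
Proof.
move=> s0 jk; rewrite lef_pV2 ?posrE ?exprn_gt0 ?expR_gt0//.
apply: lerXn2r; rewrite ?nnegrE ?expR_ge0//.
by rewrite ler_expR lerN2; apply: ge0_ler_powR; rewrite ?nnegrE ?ler0n ?ler_nat.
Qed.

Lemma fpert_L2norm (h M : nat) (u : nat -> R) : (0 < h)%N -> (2 * h <= M)%N ->
  (forall j, u j ^+ 2 = amp h j ^+ 2) ->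
  L2norm (fpert R M u \- @fcirc R) = Ab * Num.sqrt (nu phi (2 * h) ^+ 2 / x).
Proof.
move=> h0 hM uE; rewrite L2norm_fpert_diff.
rewrite (eq_bigr (fun j : 'I_M => if inblock h j then tau h ^+ 2 else 0)); last first.
  by move=> j _; rewrite uE amp_sq.
rewrite sum_block// tau_sq//.
have -> : 2^-1 * (2 * Ab ^+ 2 * (nu phi (2 * h) ^+ 2 / x)) =
   Ab ^+ 2 * (nu phi (2 * h) ^+ 2 / x) by field; rewrite gt_eqF.
by rewrite sqrtrM ?sqr_ge0// sqrtr_sqr gtr0_norm.
Qed.

(** Up to the top frequency k = 2h the weights a_j^(-2) are at most a_k^(-2), which is the inverse
    of nu_k^2 / x. This cancels against the energy of the block, and the weighted sum is at most
    Ab^2 / 2. *)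
Lemma fpert_ellipsoid (h M : nat) (u : nat -> R) (s Rad : R) : (0 < h)%N ->
  (forall j, u j ^+ 2 = amp h j ^+ 2) -> 0 <= s -> 0 <= Rad -> Ab <= Rad ->
  expseq s (2 * h) ^+ 2 = nu phi (2 * h) ^+ 2 / x ->
  ellipsoid (expseq s) Rad (fpert R M u \- @fcirc R).
Proof.
move=> h0 uE s0 Rad0 AbR sE; split; first exact: inL2_fpert_diff.
pose v := nu phi (2 * h) ^+ 2 / x.
have v0 : 0 < v.
  by rewrite divr_gt0//; apply: lt_le_trans (nu2_ge _ _) => //; rewrite muln_gt0.
pose a := v^-1 * (4^-1 * tau h ^+ 2).
have a0 : 0 <= a.
  by apply: mulr_ge0; [rewrite invr_ge0 ltW|rewrite mulr_ge0 ?sqr_ge0// invr_ge0].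
have partial m : \sum_(1 <= j < m) (expseq s j ^- 2 * fcoef_sq (fpert R M u \- @fcirc R) (Posz j))
    <= h%:R * a.
  case: m => [|m]; first by rewrite big_geq// mulr_ge0.
  rewrite big_add1 big_mkord; apply: le_trans (sum_block_le _ _ m _ a0).
  apply: ler_sum => j _; rewrite fcoef_sq_fpert_diff.
  case: ifP => jM; last by rewrite mulr0; case: ifP.
  rewrite exprMn uE amp_sq; case: ifP => [/andP[_ jh]|_]; last by rewrite !mulr0.
  rewrite /a -[v]sE; apply: ler_pM.
  - by rewrite invr_ge0 exprn_ge0// expR_ge0.
  - by rewrite mulr_ge0 ?sqr_ge0.
  - exact: expseq_inv_le.
  - by have -> : (2^-1 : R) ^+ 2 = 4^-1 by field.
have -> : (Rad ^+ 2)%:E = (2%:E * (2^-1 * Rad ^+ 2)%:E)%E :> \bar R.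
  by rewrite -EFinM mulrA divff ?mul1r.
apply: lee_wpmul2l; first by rewrite lee_fin.
apply: lime_le.
  apply: is_cvg_nneseries => j _ _; rewrite lee_fin mulr_ge0 ?invr_ge0 ?exprn_ge0 ?expR_ge0//.
  by rewrite addr_ge0 ?sqr_ge0.
apply: nearW => m; rewrite sumEFin lee_fin; apply: le_trans (partial m) _.
have -> : h%:R * a = 2^-1 * Ab ^+ 2.
  rewrite /a mulrCA [h%:R * _]mulrCA tau_sq// -/v; field; rewrite gt_eqF//.
by rewrite ler_wpM2l// lerXn2r ?nnegrE// ltW.
Qed.

End Core.

(** Separates the deterministic conditions at one sample size from their asymptotic verification.
    The block energy is at most Kc Ab^4 (n/x)^2 <= L, so the chi-square exponent is L/2. *)
Lemma lower_bound_n (R : realType) (phi : R -> R) (c C p x Ab Rad alpha L s_lo s_hi : R)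
    (Aset : set (nat -> R)) (m N n : nat) :
  density phi -> (forall j : int, 0 < fcoef_abs phi j) ->
  0 < c -> c <= C -> 0 < p ->
  (forall j : nat, (0 < j)%N ->
    c * (j%:R `^ (- p)) <= fcoef_abs phi (Posz j) <= C * (j%:R `^ (- p))) ->
  0 < x -> 0 < Ab -> Ab <= Rad -> 0 < alpha -> 0 < s_lo -> (0 < N)%N ->
  Kc R c C p * Ab ^+ 4 <= 1 -> (n%:R / x) ^+ 2 <= L -> expR (2^-1 * L) / N%:R <= alpha ^+ 2 ->
  (forall s, s_lo <= s <= s_hi -> Aset (expseq R s)) ->
  (forall i : 'I_N, let k := (2 * 2 ^ (m + i))%N in
     Ab ^+ 2 * (nu phi k ^+ 2 * k%:R) <= x /\
     exists2 s, s_lo <= s <= s_hi & expseq R s k ^+ 2 = nu phi k ^+ 2 / x) ->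
  forall (A : R) (Delta : n.-tuple R -> bool), 0 <= A <= Ab ->
  measurable (Delta @^-1` [set true]) ->
  1 - alpha <= sup [set risk phi Delta (ellipsoid a Rad) (A * rho phi a x) | a in Aset].
Proof.
move=> dphi phi0 c0 cC p0 decay x0 Ab0 AbR a0 slo0 N0 KAb nL EN subA scales A Delta /andP[A0 AAb] mD.
pose M := (2 ^ (m + N))%N.
pose b (i : 'I_N) := amp R phi x Ab (2 ^ (m + i)).
have h0 i : (0 < 2 ^ (m + i))%N by rewrite expn_gt0.
have bd (i l : 'I_N) j : i != l -> b i j * b l j = 0.
  by move=> il; apply: amp_disjoint.
have bs i : \sum_(j < M) `|b i j| <= 1.
  by apply: amp_sum => //; have [] := scales i.
have bE i : n%:R ^+ 2 * (\sum_(j < M) b i j ^+ 4 * fcoef_sq phi (Posz j.+1) ^+ 2)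
    <= 2 * (2^-1 * L).
  rewrite mulrA divff ?mul1r//.
  apply: le_trans (amp_energy _ _ _ _ _ dphi phi0 c0 cC p0 decay _ _ x0 Ab0 _ _ _ (h0 i)) _.
  by apply: le_trans nL; rewrite ler_piMl ?sqr_ge0.
have [[i e] key] := testing_lower_bound R phi dphi N M n b (2^-1 * L) bd bs bE alpha Delta mD a0 N0 EN.
have [_ [s sI sE]] := scales i.
have sI' := sI; case/andP: sI' => s1 s2.
pose k := (2 * 2 ^ (m + i))%N.
have kM : (k <= M)%N.
  by rewrite /k -expnS /M leq_exp2l// -addnS leq_add2l.
pose f := fpert R M (coef R N M b (i, e)).
have uE j : coef R N M b (i, e) j ^+ 2 = amp R phi x Ab (2 ^ (m + i)) j ^+ 2 by exact: coef_sq.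
apply: (@le_trans _ _ (risk phi Delta (ellipsoid (expseq R s) Rad) (A * rho phi (expseq R s) x))).
  apply: le_trans key _; apply: risk_ge => //.
  - by apply: density_fpert; apply: coef_abs_sum; exact: bs.
  - have sl : 0 <= s by exact: le_trans (ltW slo0) s1.
    have Rad0 : 0 <= Rad by exact: le_trans (ltW Ab0) AbR.
    exact: (fpert_ellipsoid _ _ dphi phi0 _ _ x0 Ab0 _ M _ s Rad (h0 i) uE sl Rad0 AbR sE).
  - rewrite (fpert_L2norm _ _ _ _ x0 Ab0 _ M _ (h0 i) kM uE).
    apply: ler_pM => //; first exact: sqrtr_ge0.
    (* At this k the two terms a_k^2 and nu_k^2 / x coincide, so their maximum is nu_k^2 / x and
       bounds rho_a^2. *)
    rewrite -[X in Num.sqrt X]maxxx -{1}sE; apply: rho_le.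
    by rewrite muln_gt0 h0.
apply: ub_le_sup; first by exists 2 => _ [a' _ <-]; exact: risk_le2.
by exists (expseq R s) => //; exact: subA.
Qed.

(** * Choice of scales as the sample size grows *)

(** Square root of the bound on nu^4, with sqrt(2k) weakened to 2k: only polynomial growth in k
    matters from here on. *)
Lemma nu2_le (R : realType) (phi : R -> R) (c C p : R) k :
  density phi -> (forall j : int, 0 < fcoef_abs phi j) -> 0 < c -> 0 < p ->
  (forall j : nat, (0 < j)%N ->
    c * (j%:R `^ (- p)) <= fcoef_abs phi (Posz j) <= C * (j%:R `^ (- p))) ->
  (0 < k)%N ->
  nu phi k ^+ 2 <= 2 * k%:R * (k%:R `^ p / c) ^+ 2.
Proof.
move=> dphi phi0 c0 p0 decay k0.
have B0 : 0 <= 2 * k%:R * (k%:R `^ p / c) ^+ 2 by apply: mulr_ge0; [rewrite mulr_ge0 ?ler0n|exact: sqr_ge0].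
rewrite -(@ler_pXn2r _ 2)// ?nnegrE ?sqr_ge0// -exprM (nu4E _ _ dphi phi0).
apply: le_trans (nu4_le _ _ _ _ _ phi0 c0 p0 decay k) _.
rewrite [leRHS]exprMn -[X in _ <= _ * X]exprM; apply: ler_wpM2r; first by rewrite exprn_even_ge0.
have k1 : 1 <= k%:R :> R by rewrite ler1n.
nra.
Qed.

(** Since ln k <= y / sm, the last condition makes nu_k^2 k at most x exp(-l/2). Hence the required
    value of k^s lies in [l/4, l], and its logarithm in [y - ln 4, y]. The bound s <= s_hi then
    follows from ln k >= y / s_hi; for s >= s_lo, the loss ln 4 is absorbed by the gap between s_lo
    and sm. *)
Lemma scale_exponent (R : realType) (phi : R -> R) (c C p s_lo sm s_hi x l y : R) (k : nat) :
  density phi -> (forall j : int, 0 < fcoef_abs phi j) -> 0 < c -> 0 < p ->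
  (forall j : nat, (0 < j)%N ->
    c * (j%:R `^ (- p)) <= fcoef_abs phi (Posz j) <= C * (j%:R `^ (- p))) ->
  0 < s_lo -> s_lo < sm -> sm < s_hi ->
  (1 < k)%N -> y / s_hi <= ln (k%:R : R) -> ln (k%:R : R) <= y / sm ->
  0 < x -> l - y <= ln x -> ln x <= l ->
  y = ln l -> 0 < l -> 0 < y -> ln 2 <= l -> ln 4 <= (1 - s_lo / sm) * y ->
  ln (2 / c ^+ 2) + (1 + (2 + 2 * p) / sm) * y <= l / 2 ->
  nu phi k ^+ 2 * k%:R <= x /\
  exists2 s, s_lo <= s <= s_hi & expseq R s k ^+ 2 = nu phi k ^+ 2 / x.
Proof.
move=> dphi phi0 c0 p0 decay slo0 slosm smshi k1 kl ku x0 lx xl yE l0 y0 l2 y4 big.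
have sm0 : 0 < sm by lra.
have shi0 : 0 < s_hi by lra.
have kR : 1 < k%:R :> R by rewrite ltr1n.
have kR0 : 0 < k%:R :> R by lra.
set K := ln (k%:R : R) in kl ku *.
have K0 : 0 < K by apply: ln_gt0.
set V := nu phi k ^+ 2.
have V2 : 2^-1 <= V by apply: nu2_ge => //; exact: ltnW.
have V0 : 0 < V by lra.
have lnV : - ln 2 <= ln V by rewrite -lnV ?posrE// ler_ln ?posrE.
have lnVk : ln V + K <= ln (2 / c ^+ 2) + (2 + 2 * p) * K.
  have kp0 : 0 < k%:R `^ p :> R by apply: powR_gt0.
  have := nu2_le _ _ _ _ _ k dphi phi0 c0 p0 decay (ltnW k1); rewrite -/V => h.
  have h' : V <= 2 / c ^+ 2 * (k%:R * k%:R `^ p ^+ 2).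
    by apply: le_trans h _; rewrite le_eqVlt; apply/orP; left; apply/eqP; field; rewrite gt_eqF.
  have kp2 : 0 < k%:R `^ p ^+ 2 :> R by exact: exprn_gt0.
  have kk : 0 < k%:R * k%:R `^ p ^+ 2 :> R by exact: mulr_gt0.
  have c2 : 0 < 2 / c ^+ 2 by rewrite divr_gt0// exprn_gt0.
  have : ln V <= ln (2 / c ^+ 2 * (k%:R * k%:R `^ p ^+ 2)).
    by rewrite ler_ln ?posrE//; exact: mulr_gt0.
  have -> : ln (2 / c ^+ 2 * (k%:R * k%:R `^ p ^+ 2)) = ln (2 / c ^+ 2) + (K + 2 * (p * K)).
    rewrite [LHS]lnM ?posrE//; congr (_ + _).
    by rewrite [LHS]lnM ?posrE// lnXn// ln_powR -/K mulr_natl.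
  lra.
have qK : (2 + 2 * p) * K <= (2 + 2 * p) / sm * y.
  by rewrite -mulrA [sm^-1 * y]mulrC ler_wpM2l//; lra.
have VKx : ln V + K + l / 2 <= ln x by lra.
split.
  have Vk0 : 0 < V * k%:R by exact: mulr_gt0.
  have e : ln (V * k%:R) = ln V + K by rewrite lnM ?posrE.
  rewrite -ler_ln ?posrE// e; lra.
(* The value k^s must take for exp(-2 k^s) = nu_k^2 / x. *)
pose z := 2^-1 * (ln x - ln V).
have zl : l / 4 <= z by rewrite /z; lra.
have zu : z <= l by rewrite /z; lra.
have z0 : 0 < z by lra.
have lnz1 : y - ln 4 <= ln z.
  have -> : y - ln 4 = ln (l / 4) by rewrite yE ln_div ?posrE.
  by rewrite ler_ln ?posrE//; lra.
have lnz2 : ln z <= y by rewrite yE ler_ln ?posrE.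
exists (ln z / K).
  rewrite ler_pdivlMr// ler_pdivrMr//; apply/andP; split.
    have : s_lo * K <= s_lo / sm * y.
      by rewrite -mulrA [sm^-1 * y]mulrC ler_wpM2l// ltW.
    lra.
  have : s_hi * (y / s_hi) <= s_hi * K by rewrite ler_wpM2l// ltW.
  by rewrite mulrCA divff ?gt_eqF// mulr1; lra.
rewrite /expseq -expRM_natl /powR gt_eqF// -/K divfK ?gt_eqF// lnK ?posrE//.
rewrite -[RHS]lnK ?posrE ?divr_gt0//; congr expR.
by rewrite ln_div ?posrE// /z; field.
Qed.

Theorem theorem6p3 (R : realType) (phi : R -> R) (Rad s_lo s_hi p : R)
    (Aset : set (nat -> R)) :
  density phi ->
  (forall j : int, 0 < fcoef_abs phi j) ->
  0 < Rad ->
  0 < s_lo -> s_lo < s_hi ->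
  (forall a, Aset a -> forall j : nat, (0 < j)%N ->
     0 < a j /\ a j <= 1 /\ a j.+1 <= a j) ->
  (forall s, s_lo <= s <= s_hi -> Aset (fun j : nat => expR (- (j%:R `^ s)))) ->
  decay_like phi p -> 2^-1 < p ->
  forall alpha : R, 0 < alpha < 1 ->
  exists (n0 : nat) (Abar : R), 0 < Abar /\
    forall n : nat, (n0 <= n)%N ->
    forall A : R, 0 <= A <= Abar ->
    forall Delta : n.-tuple R -> bool, measurable (Delta @^-1` [set true]) ->
      1 - alpha <=
      sup [set risk phi Delta (ellipsoid a Rad) (A * rho phi a (delta R n * n%:R))
          | a in Aset].
Proof.
move=> dphi phi0 Rad0 slo0 slohi _ subA [c [C [c0 [cC decay]]]] p12 alpha /andP[a0 _].
have p0 : 0 < p by lra.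
have shi0 : 0 < s_hi by lra.
have C0 : 0 < C by exact: lt_le_trans cC.
pose K := Kc R c C p.
have K0 : 0 < K by rewrite /K /Kc mulr_gt0// exprn_gt0// divr_gt0// mulr_gt0// powR_gt0.
(* Any point strictly between would do: the gap above s_lo leaves room for the additive constant in
   s, the gap below s_hi provides the scales. *)
pose sm := (s_lo + s_hi) / 2.
have slosm : s_lo < sm by rewrite /sm; lra.
have smshi : sm < s_hi by rewrite /sm; lra.
have sm0 : 0 < sm by lra.
(* The admissible values of ln k fill [y / s_hi, y / sm], an interval of length D y. *)
pose D := sm^-1 - s_hi^-1.
have D0 : 0 < D by rewrite subr_gt0 ltf_pV2 ?posrE.
have ln2_0 : 0 < ln 2 :> R by rewrite ln_gt0// ltr1n.
have ln4_0 : 0 < ln 4 :> R by rewrite ln_gt0// ltr1n.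
pose c1 := `|ln (2 / c ^+ 2)|.
have c1_0 : 0 <= c1 by exact: normr_ge0.
pose q1 := 1 + (2 + 2 * p) / sm.
have q1_0 : 0 <= q1 by rewrite addr_ge0// divr_ge0//; lra.
(* About D y / ln 2 = 2 y / c2 dyadic scales fit; the factor 2 absorbs the truncation, leaving N >=
   y / c2. *)
pose c2 := 2 * ln 2 / D.
have c2_0 : 0 < c2 by rewrite divr_gt0// mulr_gt0.
pose r := 1 - s_lo / sm.
have r0 : 0 < r by rewrite subr_gt0 ltr_pdivrMr// mul1r.
have e0 := expR_gt0 (1 : R).
have b1 := sqr_ge0 (c2 / alpha ^+ 2).
have b2 : 0 <= ln 4 / r by rewrite divr_ge0// ltW.
(* Lower bound for log log n, one summand per requirement: log log log n >= 1, small divergence, N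
   >= 1, log n dominating a linear function of y, s >= s_lo, and y >= 1. *)
pose Y0 := expR 1 + (c2 / alpha ^+ 2) ^+ 2 + c2 + 4 * (c1 + q1) + ln 4 / r + 1.
(* [Rad] is for the ellipsoid; (1 + K)^-1 gives both Ab <= 1 and K Ab^4 <= 1. *)
pose Ab := Num.min Rad (1 + K)^-1.
have Ab0 : 0 < Ab by rewrite lt_min Rad0 invr_gt0 addr_gt0.
exists (Num.truncn (expR (expR Y0))).+1, Ab; split => // n n0n A hA Delta mD.
have nY : expR (expR Y0) < n%:R.
  by apply: lt_le_trans (truncnS_gt _) _; rewrite ler_nat.
have nR0 : 0 < n%:R :> R by exact: lt_trans (expR_gt0 _) nY.
pose l : R := ln n%:R.
have lY : expR Y0 <= l by rewrite -(expRK (expR Y0)) ler_ln ?posrE ?expR_gt0// ltW.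
have l0 : 0 < l by exact: lt_le_trans (expR_gt0 _) lY.
pose y := ln l.
have yY : Y0 <= y by rewrite -(expRK Y0) ler_ln ?posrE ?expR_gt0.
have y1 : 1 <= y by apply: le_trans yY; rewrite /Y0; lra.
have y0 : 0 < y by lra.
have ye : expR 1 <= y by apply: le_trans yY; rewrite /Y0; lra.
pose L := ln y.
have L1 : 1 <= L by rewrite -(expRK 1) ler_ln ?posrE ?expR_gt0.
have L0 : 0 < L by lra.
have Ly : L <= y by apply: ltW; apply: ln_sublinear.
have lnL0 : 0 <= ln L by exact: ln_ge0.
have lnLL : ln L <= L by apply: ltW; apply: ln_sublinear.
have lE : expR y = l by rewrite lnK ?posrE.
have l2 : 1 + y ^+ 2 / 2 <= l by rewrite -lE; have := @expR_ge1Dxn R y 1 (ltW y0).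
have deltaE : delta R n = L `^ (- 2^-1) by rewrite /delta -/l -/y -/L max_l.
have d0 : 0 < delta R n by rewrite deltaE powR_gt0.
have x0 : 0 < delta R n * n%:R by rewrite mulr_gt0.
have lnx : ln (delta R n * n%:R) = l - 2^-1 * ln L.
  rewrite lnM ?posrE// deltaE ln_powR -/l; ring.
have nL : (n%:R / (delta R n * n%:R)) ^+ 2 <= L.
  have -> : n%:R / (delta R n * n%:R) = Num.sqrt L.
    rewrite deltaE powRN powR12_sqrt ?(ltW L0)//; field.
    by rewrite !gt_eqF// sqrtr_gt0.
  by rewrite sqr_sqrtr// ltW.
(* Here t is log n's logarithm to base 2. The scales are k = 2^(m+i+1) with i < N: the exponent
   exceeds t / s_hi by the choice of m, and it is at most m + N <= t / s_hi + t D = t / sm. *)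
pose t := y / ln 2.
have t0 : 0 < t by rewrite divr_gt0.
pose m := Num.truncn (t / s_hi).
pose N := Num.truncn (t * D).
have m1 : m%:R <= t / s_hi by rewrite truncn_le// divr_ge0// ltW.
have m2 : t / s_hi < m.+1%:R by exact: truncnS_gt.
have N1 : N%:R <= t * D by rewrite truncn_le// mulr_ge0// ltW.
have N2 : t * D < N.+1%:R by exact: truncnS_gt.
have tD : t * D = 2 * (y / c2) by rewrite /t /c2; field; rewrite !gt_eqF.
have yc2 : 1 <= y / c2.
  by rewrite ler_pdivlMr// mul1r; apply: le_trans yY; rewrite /Y0; lra.
have Ny : y / c2 <= N%:R by move: N2; rewrite -natr1; lra.
have N0 : (0 < N)%N by rewrite -(ltr0n R); lra.
have KAb : K * Ab ^+ 4 <= 1.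
  have Abk : Ab <= (1 + K)^-1 by rewrite ge_min lexx orbT.
  have k1 : (1 + K)^-1 <= 1 by rewrite invf_le1 ?lerDl ?addr_gt0// ltW.
  have : Ab ^+ 4 <= (1 + K)^-1.
    rewrite exprS; apply: le_trans (Abk); rewrite ler_piMr ?(ltW Ab0)//.
    apply: exprn_ile1; [exact: ltW|exact: le_trans Abk k1].
  move=> /(ler_wpM2l (ltW K0)) /le_trans; apply.
  by rewrite ler_pdivrMr; lra.
have Ab1 : Ab ^+ 2 <= 1.
  apply: exprn_ile1; first exact: ltW.
  by apply: (@le_trans _ _ (1 + K)^-1); [rewrite ge_min lexx orbT|rewrite invf_le1 ?lerDl ?addr_gt0// ltW].
have EN : expR (2^-1 * L) / N%:R <= alpha ^+ 2.
  pose w := expR (2^-1 * L).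
  have w0 : 0 < w by exact: expR_gt0.
  (* As L = ln y, exp(L/2) is the square root of y, and with N >= y / c2 the divergence is at most
     c2 / sqrt(y). *)
  have ww : w ^+ 2 = y by rewrite /w -expRM_natl mulrA divff// mul1r lnK ?posrE.
  have wc : c2 / alpha ^+ 2 <= w.
    have cq0 : 0 <= c2 / alpha ^+ 2 by apply: divr_ge0; [exact: ltW|exact: sqr_ge0].
    rewrite -(@ler_pXn2r _ 2)// ?nnegrE ?(ltW w0)//.
    by rewrite ww; apply: le_trans yY; rewrite /Y0; lra.
  rewrite -/w ler_pdivrMr ?ltr0n//.
  have : alpha ^+ 2 * (y / c2) <= alpha ^+ 2 * N%:R by rewrite ler_wpM2l ?sqr_ge0.
  apply: le_trans.
  have wc' : c2 <= w * alpha ^+ 2 by rewrite -ler_pdivrMr ?exprn_gt0.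
  rewrite mulrA ler_pdivlMr// -ww (_ : alpha ^+ 2 * w ^+ 2 = w * (w * alpha ^+ 2)); last by ring.
  by rewrite ler_wpM2l ?(ltW w0).
have scales (i : 'I_N) : let k := (2 * 2 ^ (m + i))%N in
     Ab ^+ 2 * (nu phi k ^+ 2 * k%:R) <= delta R n * n%:R /\
     exists2 s, s_lo <= s <= s_hi &
       expseq R s k ^+ 2 = nu phi k ^+ 2 / (delta R n * n%:R).
  set k := (2 * 2 ^ (m + i))%N => /=.
  have lnk : ln (k%:R : R) = (m + i).+1%:R * ln 2.
    by rewrite /k -expnS natrX lnXn// mulr_natl.
  have k1 : (1 < k)%N by rewrite /k -expnS -{1}(expn0 2) ltn_exp2l.
  have kl : y / s_hi <= ln (k%:R : R).
    have -> : y / s_hi = t / s_hi * ln 2 by rewrite /t; field; rewrite !gt_eqF.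
    rewrite lnk ler_wpM2r ?(ltW ln2_0)//; apply: le_trans (ltW m2) _.
    by rewrite ler_nat ltnS leq_addr.
  have ku : ln (k%:R : R) <= y / sm.
    have -> : y / sm = (t / s_hi + t * D) * ln 2.
      by rewrite /t /D; field; rewrite !gt_eqF.
    rewrite lnk ler_wpM2r ?(ltW ln2_0)//; apply: le_trans (lerD m1 N1).
    by rewrite -natrD ler_nat -addnS leq_add2l.
  have [] := scale_exponent R phi c C p s_lo sm s_hi (delta R n * n%:R) l y k
    dphi phi0 c0 p0 decay slo0 slosm smshi k1 kl ku x0.
  - rewrite lnx; lra.
  - rewrite lnx; lra.
  - by [].
  - exact: l0.
  - exact: y0.
  - have : ln 2 < 2 :> R by apply: ln_sublinear.
    have : 1 + y <= l by rewrite -lE; exact: expR_ge1Dx.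
    lra.
  - rewrite -/r mulrC -ler_pdivrMr//; apply: le_trans yY; rewrite /Y0; lra.
  (* The left side is at most (c1 + q1) y <= y^2 / 4, and l = exp y >= 1 + y^2 / 2. *)
  - rewrite -/q1.
    have h1 : ln (2 / c ^+ 2) <= c1 by exact: ler_norm.
    have h2 : 4 * (c1 + q1) <= y by apply: le_trans yY; rewrite /Y0; lra.
    have h3 : 4 * (c1 + q1) * y <= y * y by rewrite ler_wpM2r ?(ltW y0).
    have h4 : c1 <= c1 * y by rewrite ler_peMr.
    rewrite expr2 in l2; nra.
  move=> h ?; split => //; apply: le_trans h.
  by rewrite ler_piMl// mulr_ge0 ?sqr_ge0.
have AbR : Ab <= Rad by rewrite ge_min lexx.
exact: (lower_bound_n R phi c C p _ Ab Rad alpha L s_lo s_hi Aset m N n dphi phi0 c0 cC p0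
  decay x0 Ab0 AbR a0 slo0 N0 KAb nL EN subA scales A Delta hA mD).
Qed.
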